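(* Let $a\in\mathbb R$ and, for $\epsilon\neq0$ small, consider the immersion $\alpha_\epsilon(u,v)=(u,uv,v^2,\epsilon v+\tfrac a6v^3)$ in a neighborhood of the origin of $\mathbb R^2$ (the neighborhood and the smallness of $\epsilon$ may depend on $a$). Then the following holds for its axiumbilic points: (1) If $|a|\le 8$ and $\epsilon\ne0$, then $\alpha_\epsilon$ has two axiumbilic points. (2) If $a>8$, then $\alpha_\epsilon$ has four axiumbilic points when $\epsilon>0$ and no axiumbilic points when $\epsilon<0$. (3) If $a<-8$, then $\alpha_\epsilon$ has four axiumbilic points when $\epsilon<0$ and no axiumbilic points when $\epsilon>0$. Moreover: (4) If $a>8$ (so that the axiumbilic points occur for $\epsilon>0$), two of the axiumbilic points are of type $E_3$ and two are of type $E_5$. (5) If $a<-8$ (so that the axiumbilic points occur for $\epsilon<0$), two of the axiumbilic points are of type $E_3$ and two are of type $E_5$. (6) If $|a|<\frac{15}2$, the two axiumbilic points are of type $E_3$. (7) If $\frac{15}2<|a|<8$, the two axiumbilic points are of type $E_4$.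
   Context: For an immersion $\alpha$ of a surface into Euclidean $\mathbb R^4$ with first fundamental form $I_\alpha$ and normal-bundle valued second fundamental form $II_\alpha$, the normal curvature vector is $k_n(p,\vec v)=II_\alpha(\vec v)/I_\alpha(\vec v)$; the image of the $I_\alpha$-unit circle under $k_n(p,\cdot)$ is the ellipse of curvature, centered at the mean normal curvature vector $H(p)$. A point is axiumbilic if this ellipse is a circle or a point. The differential equation of axial lines is $\mathrm{Jac}(\|k_n-H\|^2,I_\alpha)=0$ (Jacobian with respect to the components of the direction); at a non-axiumbilic point its solutions are the four directions at which $k_n$ is at a vertex of the ellipse of curvature. The axial configurations (principal axial and mean axial) are formed by the integral curves of the directions where $\|k_n-H\|^2$ is maximal, respectively minimal. Near an axiumbilic point $p$ there exist a local parametrization as a graph $(x,y,R(x,y),S(x,y))$ and a homothety of $\mathbb R^4$ such that the differential equation of axial lines becomes $$y(dy^4-6dx^2dy^2+dx^4)+(\lambda x+\mu y)\,dx\,dy\,(dx^2-dy^2)+\mathcal H(x,y,dx,dy)=0,$$ with $\mathcal H$ containing only terms of order $\ge2$ in $(x,y)$. The point $p$ is a transversal axiumbilic point if and only if $\lambda\neq0$. Let $$\Delta(\lambda,\mu)=(\lambda+1)^2[I^3-27J^2],\quad I=2\lambda\Big(\frac{\lambda}{24}+1\Big)+4+\frac{\mu^2}4,\quad J=-\frac{2\lambda}3\Big[\Big(\frac\lambda6+1\Big)\Big(1-\frac\lambda{24}\Big)+\frac{\mu^2}{16}\Big].$$ A transversal axiumbilic point is of type - $E_3$ if $\Delta(\lambda,\mu)<0$;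 the axial configurations then have three axiumbilic separatrices; - $E_4$ if $\Delta(\lambda,\mu)>0$, $\lambda<0$ and $\lambda\neq-1$; the axial configurations then have four axiumbilic separatrices and one parabolic sector; - $E_5$ if $\Delta(\lambda,\mu)>0$ and $\lambda>0$; the axial configurations then have five axiumbilic separatrices.
   Formalization: In (7) the formal statement adds the hypothesis aε<0: for 15/2<|a|<8 and aε>0 the two axiumbilic points have μ=0 and λ close to −(16+2|a|), so Δ<0 and they are of type E_3, not E_4. *)

(* Defs.v *)
(* Stdlib real numbers, with Coquelicot for derivatives and neighbourhoods. *)
From Stdlib Require Import Reals List.
From Coquelicot Require Import Coquelicot.
Open Scope R_scope.

Definition R4 : NormedModule R_AbsRing :=
  prod_NormedModule R_AbsRing
    (prod_NormedModule R_AbsRing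
       (prod_NormedModule R_AbsRing R_NormedModule R_NormedModule)
       R_NormedModule)
    R_NormedModule.

Definition vec4 (x1 x2 x3 x4 : R) : R4 := (x1, x2, x3, x4).

Definition co1 (x : R4) : R := fst (fst (fst x)).
Definition co2 (x : R4) : R := snd (fst (fst x)).
Definition co3 (x : R4) : R := snd (fst x).
Definition co4 (x : R4) : R := snd x.

(* The Euclidean structure; the norm carried by the product [R4] in Coquelicot
   is not used. *)
Definition dot (x y : R4) : R :=
  co1 x * co1 y + co2 x * co2 y + co3 x * co3 y + co4 x * co4 y.
Definition enorm (x : R4) : R := sqrt (dot x x).

Definition DeriveR4 (c : R -> R4) (t : R) : R4 :=
  vec4 (Derive (fun s => co1 (c s)) t) (Derive (fun s => co2 (c s)) t)
       (Derive (fun s => co3 (c s)) t) (Derive (fun s => co4 (c s)) t).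

Definition du_ (X : R -> R -> R4) (u v : R) : R4 :=
  DeriveR4 (fun s => X s v) u.
Definition dv_ (X : R -> R -> R4) (u v : R) : R4 :=
  DeriveR4 (fun s => X u s) v.

(* In the definitions up to [axial_jacobian], [X] is a parametrized surface,
   [u], [v] are the parameters of the point, and [a], [b] are the components of
   a tangent direction, that is, the values of the differentials of the two
   parameters. *)

Definition coefE (X : R -> R -> R4) (u v : R) := dot (du_ X u v) (du_ X u v).
Definition coefF (X : R -> R -> R4) (u v : R) := dot (du_ X u v) (dv_ X u v).
Definition coefG (X : R -> R -> R4) (u v : R) := dot (dv_ X u v) (dv_ X u v).

Definition area2 (X : R -> R -> R4) (u v : R) : R :=
  coefE X u v * coefG X u v - (coefF X u v)^2.

Definition first_form (X : R -> R -> R4) (u v a b : R) : R :=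
  coefE X u v * a^2 + 2 * coefF X u v * a * b + coefG X u v * b^2.

(* The tangential part of [w] is found by solving the Gram system of the
   basis [du_ X], [dv_ X]. *)
Definition normal_part (X : R -> R -> R4) (u v : R) (w : R4) : R4 :=
  let p := dot w (du_ X u v) in
  let q := dot w (dv_ X u v) in
  minus w
    (plus
      (scal ((coefG X u v * p - coefF X u v * q) / area2 X u v) (du_ X u v))
      (scal ((coefE X u v * q - coefF X u v * p) / area2 X u v) (dv_ X u v))).

Definition II11 (X : R -> R -> R4) (u v : R) : R4 :=
  normal_part X u v (du_ (du_ X) u v).
Definition II12 (X : R -> R -> R4) (u v : R) : R4 :=
  normal_part X u v (du_ (dv_ X) u v).
Definition II22 (X : R -> R -> R4) (u v : R) : R4 :=
  normal_part X u v (dv_ (dv_ X) u v).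

Definition second_form (X : R -> R -> R4) (u v a b : R) : R4 :=
  plus (plus (scal (a^2) (II11 X u v)) (scal (2 * a * b) (II12 X u v)))
       (scal (b^2) (II22 X u v)).

Definition normal_curvature (X : R -> R -> R4) (u v a b : R) : R4 :=
  scal (/ first_form X u v a b) (second_form X u v a b).

(* Half the trace of the second fundamental form with respect to the first. *)
Definition mean_curvature (X : R -> R -> R4) (u v : R) : R4 :=
  scal (/ (2 * area2 X u v))
    (plus (plus (scal (coefG X u v) (II11 X u v))
                (scal (- 2 * coefF X u v) (II12 X u v)))
          (scal (coefE X u v) (II22 X u v))).

Definition curvature_ellipse (X : R -> R -> R4) (u v : R) : R4 -> Prop :=
  fun k => exists a b : R,
    first_form X u v a b = 1 /\ k = normal_curvature X u v a b.

Definition is_point (S : R4 -> Prop) : Prop :=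
  exists c : R4, forall k, S k <-> k = c.

(* A circle of positive radius [r] and centre [c], in the affine plane through
   [c] spanned by the orthonormal pair [e], [f]. *)
Definition is_circle (S : R4 -> Prop) : Prop :=
  exists (c e f : R4) (r : R),
    0 < r /\ dot e e = 1 /\ dot f f = 1 /\ dot e f = 0 /\
    forall k, S k <->
      exists s t : R, s^2 + t^2 = r^2 /\ k = plus c (plus (scal s e) (scal t f)).

Definition axiumbilic (X : R -> R -> R4) (p : R * R) : Prop :=
  is_circle (curvature_ellipse X (fst p) (snd p)) \/
  is_point (curvature_ellipse X (fst p) (snd p)).

Definition axial_function (X : R -> R -> R4) (u v a b : R) : R :=
  (enorm (minus (normal_curvature X u v a b) (mean_curvature X u v)))^2.

Definition jacobian (f g : R -> R -> R) (a b : R) : R :=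
  Derive (fun s => f s b) a * Derive (fun s => g a s) b -
  Derive (fun s => f a s) b * Derive (fun s => g s b) a.

Definition axial_jacobian (X : R -> R -> R4) (u v a b : R) : R :=
  jacobian (axial_function X u v) (first_form X u v) a b.

Definition smooth_near0 (f : R -> R -> R) : Prop :=
  exists d : posreal, forall (n : nat) (x y : R),
    Rabs x < d -> Rabs y < d -> ex_diff_n f n x y.

(* Homotheties composed with rigid motions: a map that multiplies all
   distances by a fixed positive ratio is affine. *)
Definition similarity (T : R4 -> R4) : Prop :=
  exists rho : R, 0 < rho /\
    forall x y : R4, enorm (minus (T x) (T y)) = rho * enorm (minus x y).

Definition graph (r s : R -> R -> R) (x y : R) : R4 :=
  vec4 x y (r x y) (s x y).

(* Near [p] and after a similarity of the ambient space, [X] is the graph of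
   [(r, s)].  The smooth change of parameters [(x, y) |-> (phi x y, psi x y)]
   sends [(0, 0)] to [p]; it is an immersion, because composing it with [T o X]
   gives a graph. *)
Definition local_graph (X : R -> R -> R4) (p : R * R) (r s : R -> R -> R) : Prop :=
  smooth_near0 r /\ smooth_near0 s /\
  exists (T : R4 -> R4) (phi psi : R -> R -> R),
    similarity T /\ smooth_near0 phi /\ smooth_near0 psi /\
    (phi 0 0, psi 0 0) = p /\
    locally (0, 0) (fun z : R * R =>
      T (X (phi (fst z) (snd z)) (psi (fst z) (snd z)))
      = graph r s (fst z) (snd z)).

(* The equation [axial_jacobian Y = 0] is the equation
     y (dy^4 - 6 dx^2 dy^2 + dx^4) + (lam x + mu y) dx dy (dx^2 - dy^2)
       + h (x, y, dx, dy) = 0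
   with [h] of order at least 2 in (x, y).  The factor [first_form ^ 2] clears
   the denominators and makes the left-hand side a quartic form in (dx, dy);
   an equation is only defined up to the nonzero constant [k]. *)
Definition axial_normal_form (Y : R -> R -> R4) (lam mu : R) : Prop :=
  exists k C : R, k <> 0 /\
    locally (0, 0) (fun z : R * R =>
      let x := fst z in let y := snd z in
      forall a b : R,
        Rabs (k * ((first_form Y x y a b)^2 * axial_jacobian Y x y a b)
              - (y * (b^4 - 6 * a^2 * b^2 + a^4)
                 + (lam * x + mu * y) * a * b * (a^2 - b^2)))
        <= C * (x^2 + y^2) * (a^2 + b^2)^2).

Definition has_normal_form (X : R -> R -> R4) (p : R * R) (lam mu : R) : Prop :=
  exists r s : R -> R -> R,
    local_graph X p r s /\ axial_normal_form (graph r s) lam mu.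

Definition invI (lam mu : R) : R :=
  2 * lam * (lam / 24 + 1) + 4 + mu^2 / 4.
Definition invJ (lam mu : R) : R :=
  - (2 * lam / 3) * ((lam / 6 + 1) * (1 - lam / 24) + mu^2 / 16).
Definition Delta (lam mu : R) : R :=
  (lam + 1)^2 * ((invI lam mu)^3 - 27 * (invJ lam mu)^2).

(* In the three types, transversality is the condition [lam <> 0]. *)
Definition type_E3 (X : R -> R -> R4) (p : R * R) : Prop :=
  axiumbilic X p /\
  exists lam mu : R, has_normal_form X p lam mu /\
    lam <> 0 /\ Delta lam mu < 0.

Definition type_E4 (X : R -> R -> R4) (p : R * R) : Prop :=
  axiumbilic X p /\
  exists lam mu : R, has_normal_form X p lam mu /\
    lam <> 0 /\ Delta lam mu > 0 /\ lam < 0 /\ lam <> -1.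

Definition type_E5 (X : R -> R -> R4) (p : R * R) : Prop :=
  axiumbilic X p /\
  exists lam mu : R, has_normal_form X p lam mu /\
    lam <> 0 /\ Delta lam mu > 0 /\ lam > 0.

Definition alpha (a eps : R) (u v : R) : R4 :=
  vec4 u (u * v) (v^2) (eps * v + a / 6 * v^3).

Definition axiumbilic_in (V : R * R -> Prop) (X : R -> R -> R4) (p : R * R) : Prop :=
  V p /\ axiumbilic X p.

(* [l] enumerates without repetition the points satisfying [P]. *)
Definition enumerates (l : list (R * R)) (P : R * R -> Prop) : Prop :=
  NoDup l /\ forall p, In p l <-> P p.

Definition has_exactly (n : nat) (P : R * R -> Prop) : Prop :=
  exists l : list (R * R), length l = n /\ enumerates l P.

(* Main.v *)
Require Import Defs.
From Stdlib Require Import Reals List Ranalysis5 Lra Psatz.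
From Coquelicot Require Import Coquelicot.
Open Scope R_scope.

(* Write w = v^2 and g = eps + a v^2 / 2.  Since II(d_u, d_u) = 0, the
   axiumbilic points are cut out by two equations between Gram determinants;
   near the origin they reduce to u = 0 and
     4 w + g^2 = sigma (1 + w) (g - a w),   sigma = 1 or -1,
   which is quadratic in w and depends on sigma only through b = sigma a and
   e = sigma eps.  It has one small positive root w if b >= -8 and e > 0, or if
   b < -8 and e < 0, and none otherwise; each root gives the two points
   v = +- sqrt w.

   At such a point a rigid motion turns alpha into a graph of the special form
   (x, y, y rho(x), s(x)).  For these graphs the linear part of the axial
   equation is explicit; it has mu = 0 and lam = 8 - 2 s2 s3 / (rho1 rho2) in
   terms of the Taylor coefficients at 0.  Here lam tends to -16 - 2 b as
   v and eps tend to 0.  As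
     Delta (lam, 0) = (lam + 1)^3 (lam^2 + 8 lam + 32)^2 / 16,
   the type is E3, E4 or E5 according to b > -15/2, -8 < b < -15/2 or
   b < -8. *)

(** * Euclidean algebra of R4 and the ellipse of curvature *)

Lemma vec4_eta (x : R4) : x = vec4 (co1 x) (co2 x) (co3 x) (co4 x).
Proof. destruct x as [[[x1 x2] x3] x4]. reflexivity. Qed.

Lemma vec4_ext (x y : R4) :
  co1 x = co1 y -> co2 x = co2 y -> co3 x = co3 y -> co4 x = co4 y -> x = y.
Proof.
  intros H1 H2 H3 H4. rewrite (vec4_eta x), (vec4_eta y), H1, H2, H3, H4.
  reflexivity.
Qed.

Lemma co1_plus (x y : R4) : co1 (plus x y) = co1 x + co1 y.
Proof. reflexivity. Qed.
Lemma co2_plus (x y : R4) : co2 (plus x y) = co2 x + co2 y.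
Proof. reflexivity. Qed.
Lemma co3_plus (x y : R4) : co3 (plus x y) = co3 x + co3 y.
Proof. reflexivity. Qed.
Lemma co4_plus (x y : R4) : co4 (plus x y) = co4 x + co4 y.
Proof. reflexivity. Qed.
Lemma co1_minus (x y : R4) : co1 (minus x y) = co1 x - co1 y.
Proof. reflexivity. Qed.
Lemma co2_minus (x y : R4) : co2 (minus x y) = co2 x - co2 y.
Proof. reflexivity. Qed.
Lemma co3_minus (x y : R4) : co3 (minus x y) = co3 x - co3 y.
Proof. reflexivity. Qed.
Lemma co4_minus (x y : R4) : co4 (minus x y) = co4 x - co4 y.
Proof. reflexivity. Qed.
Lemma co1_scal (k : R) (x : R4) : co1 (scal k x) = k * co1 x.
Proof. reflexivity. Qed.
Lemma co2_scal (k : R) (x : R4) : co2 (scal k x) = k * co2 x.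
Proof. reflexivity. Qed.
Lemma co3_scal (k : R) (x : R4) : co3 (scal k x) = k * co3 x.
Proof. reflexivity. Qed.
Lemma co4_scal (k : R) (x : R4) : co4 (scal k x) = k * co4 x.
Proof. reflexivity. Qed.
Lemma co1_vec4 (x1 x2 x3 x4 : R) : co1 (vec4 x1 x2 x3 x4) = x1.
Proof. reflexivity. Qed.
Lemma co2_vec4 (x1 x2 x3 x4 : R) : co2 (vec4 x1 x2 x3 x4) = x2.
Proof. reflexivity. Qed.
Lemma co3_vec4 (x1 x2 x3 x4 : R) : co3 (vec4 x1 x2 x3 x4) = x3.
Proof. reflexivity. Qed.
Lemma co4_vec4 (x1 x2 x3 x4 : R) : co4 (vec4 x1 x2 x3 x4) = x4.
Proof. reflexivity. Qed.

Create HintDb r4.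
Hint Rewrite co1_plus co2_plus co3_plus co4_plus co1_minus co2_minus co3_minus
  co4_minus co1_scal co2_scal co3_scal co4_scal co1_vec4 co2_vec4 co3_vec4
  co4_vec4 : r4.

Lemma dot_comm (x y : R4) : dot x y = dot y x.
Proof. unfold dot; ring. Qed.
Lemma dot_plus_l (x y z : R4) : dot (plus x y) z = dot x z + dot y z.
Proof. unfold dot; autorewrite with r4; ring. Qed.
Lemma dot_plus_r (x y z : R4) : dot z (plus x y) = dot z x + dot z y.
Proof. unfold dot; autorewrite with r4; ring. Qed.
Lemma dot_minus_l (x y z : R4) : dot (minus x y) z = dot x z - dot y z.
Proof. unfold dot; autorewrite with r4; ring. Qed.
Lemma dot_minus_r (x y z : R4) : dot z (minus x y) = dot z x - dot z y.
Proof. unfold dot; autorewrite with r4; ring. Qed.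
Lemma dot_scal_l (k : R) (x y : R4) : dot (scal k x) y = k * dot x y.
Proof. unfold dot; autorewrite with r4; ring. Qed.
Lemma dot_scal_r (k : R) (x y : R4) : dot x (scal k y) = k * dot x y.
Proof. unfold dot; autorewrite with r4; ring. Qed.

Hint Rewrite dot_plus_l dot_plus_r dot_minus_l dot_minus_r dot_scal_l
  dot_scal_r : dots.

Lemma dot_pos (x : R4) : 0 <= dot x x.
Proof. unfold dot; nra. Qed.

Lemma dot_self_eq0 (x : R4) : dot x x = 0 -> x = vec4 0 0 0 0.
Proof.
  unfold dot; intros H. apply vec4_ext; autorewrite with r4; nra.
Qed.

Lemma enorm_sqr (x : R4) : (enorm x)^2 = dot x x.
Proof. unfold enorm. rewrite pow2_sqrt; [reflexivity | apply dot_pos]. Qed.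

Lemma normal_dot (X : R -> R -> R4) (u v : R) (w z : R4) :
  area2 X u v <> 0 ->
  area2 X u v * dot (normal_part X u v w) (normal_part X u v z) =
  area2 X u v * dot w z
  - (coefG X u v * dot w (du_ X u v) * dot z (du_ X u v)
     - coefF X u v * (dot w (du_ X u v) * dot z (dv_ X u v)
                      + dot w (dv_ X u v) * dot z (du_ X u v))
     + coefE X u v * dot w (dv_ X u v) * dot z (dv_ X u v)).
Proof.
  intros HD. unfold normal_part. autorewrite with dots.
  rewrite (dot_comm (dv_ X u v) (du_ X u v)), (dot_comm (du_ X u v) z),
    (dot_comm (dv_ X u v) z).
  fold (coefE X u v) (coefF X u v) (coefG X u v).
  unfold area2 in *. field. exact HD.
Qed.

Lemma normal_part_zero (X : R -> R -> R4) (u v : R) :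
  normal_part X u v (vec4 0 0 0 0) = vec4 0 0 0 0.
Proof.
  unfold normal_part.
  assert (H : forall z, dot (vec4 0 0 0 0) z = 0)
    by (intros z; unfold dot; autorewrite with r4; ring).
  rewrite !H.
  apply vec4_ext; autorewrite with r4; unfold Rdiv; ring.
Qed.

Lemma unit_circle_double (c s : R) :
  c^2 + s^2 = 1 -> exists x y, x^2 + y^2 = 1 /\ x^2 - y^2 = c /\ 2 * x * y = s.
Proof.
  intros H. destruct (Req_dec c (-1)) as [->|Hc].
  - exists 0, 1. assert (s = 0) by nra. subst; lra.
  - assert (0 < 1 + c) by (assert (-1 <= c) by nra; lra).
    assert (Hq : sqrt ((1 + c) / 2) ^ 2 = (1 + c) / 2)
      by (apply pow2_sqrt; lra).
    set (q := sqrt ((1 + c) / 2)) in *.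
    assert (q <> 0) by (intros E; rewrite E in Hq; lra).
    assert (Hy : (s / (2 * q))^2 = (1 - c) / 2).
    { replace ((s / (2 * q))^2) with (s^2 / (4 * q^2)) by (field; lra).
      rewrite Hq. apply (Rmult_eq_reg_r (4 * ((1 + c) / 2))); [|lra].
      field_simplify; [nra | lra]. }
    exists q, (s / (2 * q)). rewrite Hy, Hq.
    split; [lra|split; [lra|field; lra]].
Qed.

(* An affine image of the unit circle that lies on a sphere is a circle or a
   point: evaluate the squared distance to the centre at five angles. *)
Lemma affine_circle_iff (S : R4 -> Prop) (h B C : R4) :
  (forall k, S k <-> exists c s, c^2 + s^2 = 1 /\
     k = plus h (plus (scal c B) (scal s C))) ->
  (is_circle S \/ is_point S) <-> (dot B B = dot C C /\ dot B C = 0).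
Proof.
  intros HS.
  assert (Hsph : forall o r2, (forall k, S k -> dot (minus k o) (minus k o) = r2) ->
     dot B B = dot C C /\ dot B C = 0).
  { intros o r2 H.
    assert (K : forall c s, c^2 + s^2 = 1 ->
       dot (minus h o) (minus h o) + c^2 * dot B B + s^2 * dot C C
       + 2 * c * dot (minus h o) B + 2 * s * dot (minus h o) C
       + 2 * (c * s) * dot B C = r2).
    { intros c s Hcs. rewrite <- (H (plus h (plus (scal c B) (scal s C)))).
      - unfold dot; autorewrite with r4; ring.
      - apply HS. exists c, s. auto. }
    pose proof (K 1 0 ltac:(lra)). pose proof (K (-1) 0 ltac:(lra)).
    pose proof (K 0 1 ltac:(lra)). pose proof (K 0 (-1) ltac:(lra)).
    pose proof (K (3/5) (4/5) ltac:(lra)). split; lra. }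
  split.
  - intros [(o & e & f & r & Hr & He & Hf & Hef & H) | (o & H)].
    + apply (Hsph o (r^2)). intros k Hk. apply H in Hk.
      destruct Hk as (s & t & Hst & ->).
      transitivity (s^2 * dot e e + t^2 * dot f f + 2 * s * t * dot e f).
      * unfold dot; autorewrite with r4; ring.
      * rewrite He, Hf, Hef. lra.
    + apply (Hsph o 0). intros k Hk. apply H in Hk. subst.
      unfold dot; autorewrite with r4; ring.
  - intros [HBC H0].
    destruct (Req_dec (dot B B) 0) as [E|E].
    + right. exists h. intros k. rewrite HS.
      assert (HB := dot_self_eq0 B E). rewrite E in HBC.
      assert (HC := dot_self_eq0 C (eq_sym HBC)). subst B C.
      assert (Hk : forall c s : R,
        plus h (plus (scal c (vec4 0 0 0 0)) (scal s (vec4 0 0 0 0))) = h)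
        by (intros; apply vec4_ext; autorewrite with r4; ring).
      split.
      * intros (c & s & _ & ->). apply Hk.
      * intros ->. exists 1, 0. split; [lra|]. rewrite Hk; reflexivity.
    + left. pose proof (dot_pos B).
      assert (Hr : sqrt (dot B B) ^ 2 = dot B B) by (apply pow2_sqrt; lra).
      assert (Hr0 : 0 < sqrt (dot B B)) by (apply sqrt_lt_R0; lra).
      set (r := sqrt (dot B B)) in *.
      exists h, (scal (/ r) B), (scal (/ r) C), r.
      autorewrite with dots. rewrite <- HBC, <- Hr, H0.
      repeat split; try lra; try (field; lra).
      * intros Hk. apply HS in Hk. destruct Hk as (c & s & Hcs & ->).
        exists (r * c), (r * s). split; [nra|].
        apply vec4_ext; autorewrite with r4; field; lra.
      * intros (s & t & Hst & ->). apply HS. exists (s / r), (t / r). split.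
        -- replace ((s / r)^2 + (t / r)^2) with ((s^2 + t^2) / r^2)
             by (field; lra). rewrite Hst; field; lra.
        -- apply vec4_ext; autorewrite with r4; field; lra.
Qed.

Lemma ellipse_circle_iff (S : R4 -> Prop) (E F G : R) (P Q : R4) :
  0 < E -> 0 < E * G - F^2 ->
  (forall k, S k <-> exists a b,
     E * a^2 + 2 * F * a * b + G * b^2 = 1 /\
     k = plus (scal (2 * a * b) P) (scal (b^2) Q)) ->
  (is_circle S \/ is_point S) <->
  (E * dot P Q = 2 * F * dot P P /\ E * dot Q Q = 4 * G * dot P P).
Proof.
  intros HE HD HS.
  remember (E * G - F^2) as D eqn:HDe.
  assert (He : sqrt E ^ 2 = E) by (apply pow2_sqrt; lra).
  assert (He0 : 0 < sqrt E) by (apply sqrt_lt_R0; lra).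
  assert (Hd : sqrt D ^ 2 = D) by (apply pow2_sqrt; lra).
  assert (Hd0 : 0 < sqrt D) by (apply sqrt_lt_R0; lra).
  set (e := sqrt E) in *. set (d := sqrt D) in *.
  set (B := scal (/ (2 * D)) (minus (scal (2 * F) P) (scal E Q))).
  set (C := scal (/ d) P).
  rewrite (affine_circle_iff S (scal (-1) B) B C).
  - unfold B, C. autorewrite with dots. rewrite (dot_comm Q P).
    set (m11 := dot P P). set (m12 := dot P Q). set (m22 := dot Q Q).
    assert (Hdd : / d * (/ d * m11) = m11 / D) by (rewrite <- Hd; field; lra).
    rewrite Hdd.
    split.
    + intros [H1 H2].
      assert (A1 : E * m12 = 2 * F * m11).
      { apply (Rmult_eq_compat_r (2 * D * d)) in H2.
        field_simplify in H2; try lra. }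
      split; [exact A1|].
      apply (Rmult_eq_compat_r (4 * D ^ 2)) in H1.
      field_simplify in H1; try lra.
      apply (Rmult_eq_reg_l E); [|lra].
      pose proof (f_equal (Rmult F) A1). rewrite HDe in H1. lra.
    + intros [H1 H2].
      assert (A1 : m12 = 2 * F * m11 / E) by (rewrite <- H1; field; lra).
      assert (A2 : m22 = 4 * G * m11 / E) by (rewrite <- H2; field; lra).
      rewrite A1, A2. split; [|field; lra].
      assert (HG : G = (D + F^2) / E) by (rewrite HDe; field; lra).
      rewrite HG; field; lra.
  - intros k. rewrite HS. split.
    + intros (a & b & H & ->).
      set (c := (E * a + F * b) / e). set (s := b * d / e).
      assert (Hcs : c^2 + s^2 = 1).
      { unfold c, s. replace (((E * a + F * b) / e) ^ 2 + (b * d / e) ^ 2)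
          with (((E * a + F * b)^2 + b^2 * d^2) / e^2) by (field; lra).
        rewrite He, Hd, <- H, HDe. field; lra. }
      exists (c^2 - s^2), (2 * c * s). split.
      { transitivity ((c^2 + s^2)^2); [ring | rewrite Hcs; ring]. }
      assert (Hs2 : b^2 = E / D * ((1 - (c^2 - s^2)) / 2)).
      { replace ((1 - (c^2 - s^2)) / 2) with (s^2) by lra.
        unfold s. replace ((b * d / e)^2) with (b^2 * d^2 / e^2) by (field; lra).
        rewrite Hd, He; field; lra. }
      assert (Hab : 2 * a * b
        = 2 * c * s / d - 2 * F / D * ((1 - (c^2 - s^2)) / 2)).
      { replace ((1 - (c^2 - s^2)) / 2) with (s^2) by lra.
        unfold c, s.
        replace ((b * d / e)^2) with (b^2 * d^2 / e^2) by (field; lra).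
        rewrite Hd, He.
        replace (2 * ((E * a + F * b) / e) * (b * d / e) / d)
          with (2 * (E * a + F * b) * b / e^2) by (field; lra).
        rewrite He; field; lra. }
      rewrite Hs2, Hab. unfold B, C.
      apply vec4_ext; autorewrite with r4; field; lra.
    + intros (c2 & s2 & H & ->).
      destruct (unit_circle_double c2 s2 H) as (c & s & Hcs & Hc & Hs).
      set (a := c / e - F * s / (e * d)). set (b := s * e / d).
      assert (Hb2 : b^2 = E / D * ((1 - c2) / 2)).
      { replace ((1 - c2) / 2) with (s^2) by lra. unfold b.
        replace ((s * e / d)^2) with (s^2 * e^2 / d^2) by (field; lra).
        rewrite Hd, He; field; lra. }
      assert (Hab : 2 * a * b = s2 / d - 2 * F / D * ((1 - c2) / 2)).
      { replace ((1 - c2) / 2) with (s^2) by lra. unfold a, b.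
        rewrite <- Hs, <- Hd. field; lra. }
      assert (HI : E * a^2 + 2 * F * a * b + G * b^2 = 1).
      { unfold a, b.
        assert (HG : G = (D + F^2) / E) by (rewrite HDe; field; lra).
        rewrite HG, <- Hcs, <- He, <- Hd. field; lra. }
      exists a, b. split; [exact HI|].
      rewrite Hb2, Hab. unfold B, C.
      apply vec4_ext; autorewrite with r4; field; lra.
Qed.

Lemma axiumbilic_iff (X : R -> R -> R4) (u v : R) :
  0 < coefE X u v -> 0 < area2 X u v -> II11 X u v = vec4 0 0 0 0 ->
  axiumbilic X (u, v) <->
  (coefE X u v * dot (II12 X u v) (II22 X u v)
     = 2 * coefF X u v * dot (II12 X u v) (II12 X u v) /\
   coefE X u v * dot (II22 X u v) (II22 X u v)
     = 4 * coefG X u v * dot (II12 X u v) (II12 X u v)).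
Proof.
  intros HE HD H11. apply ellipse_circle_iff; [exact HE | exact HD |].
  intros k. unfold curvature_ellipse, normal_curvature, second_form, first_form.
  simpl fst; simpl snd. rewrite H11.
  generalize (II12 X u v) (II22 X u v); intros P Q.
  assert (H : forall a b, scal (/ 1)
     (plus (plus (scal (a^2) (vec4 0 0 0 0)) (scal (2 * a * b) P)) (scal (b^2) Q))
     = plus (scal (2 * a * b) P) (scal (b^2) Q))
    by (intros; apply vec4_ext; autorewrite with r4; field).
  split; intros (a & b & HI & ->); exists a, b; (split; [exact HI|]).
  - rewrite HI. apply H.
  - rewrite HI. symmetry. apply H.
Qed.

(** * The axiumbilic points of alpha *)

Lemma DeriveR4_unique (c : R -> R4) (t d1 d2 d3 d4 : R) :
  is_derive (fun s => co1 (c s)) t d1 -> is_derive (fun s => co2 (c s)) t d2 ->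
  is_derive (fun s => co3 (c s)) t d3 -> is_derive (fun s => co4 (c s)) t d4 ->
  DeriveR4 c t = vec4 d1 d2 d3 d4.
Proof.
  intros H1 H2 H3 H4. unfold DeriveR4.
  f_equal; apply is_derive_unique; assumption.
Qed.

Lemma DeriveR4_ext_loc (c d : R -> R4) (t : R) :
  locally t (fun s => c s = d s) -> DeriveR4 c t = DeriveR4 d t.
Proof.
  intros H. unfold DeriveR4.
  f_equal; apply Derive_ext_loc; revert H; apply filter_imp;
    intros s ->; reflexivity.
Qed.

Lemma DeriveR4_ext (c d : R -> R4) (t : R) :
  (forall s, c s = d s) -> DeriveR4 c t = DeriveR4 d t.
Proof.
  intros H. apply DeriveR4_ext_loc. apply filter_forall. exact H.
Qed.

Lemma du_alpha (a eps u v : R) : du_ (alpha a eps) u v = vec4 1 v 0 0.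
Proof.
  apply DeriveR4_unique; unfold alpha; cbn -[pow];
    auto_derive; trivial; ring.
Qed.

Lemma dv_alpha (a eps u v : R) :
  dv_ (alpha a eps) u v = vec4 0 u (2 * v) (eps + a * v^2 / 2).
Proof.
  apply DeriveR4_unique; unfold alpha; cbn -[pow];
    auto_derive; trivial; field.
Qed.

Lemma duu_alpha (a eps u v : R) :
  du_ (du_ (alpha a eps)) u v = vec4 0 0 0 0.
Proof.
  unfold du_ at 1.
  rewrite (DeriveR4_ext _ (fun _ => vec4 1 v 0 0))
    by (intros; apply du_alpha).
  apply DeriveR4_unique; cbn; auto_derive; trivial; ring.
Qed.

Lemma duv_alpha (a eps u v : R) :
  du_ (dv_ (alpha a eps)) u v = vec4 0 1 0 0.
Proof.
  unfold du_.
  rewrite (DeriveR4_ext _ (fun s => vec4 0 s (2 * v) (eps + a * v^2 / 2)))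
    by (intros; apply dv_alpha).
  apply DeriveR4_unique; cbn -[pow]; auto_derive; trivial; ring.
Qed.

Lemma dvv_alpha (a eps u v : R) :
  dv_ (dv_ (alpha a eps)) u v = vec4 0 0 2 (a * v).
Proof.
  unfold dv_ at 1.
  rewrite (DeriveR4_ext _ (fun s => vec4 0 u (2 * s) (eps + a * s^2 / 2)))
    by (intros; apply dv_alpha).
  apply DeriveR4_unique; cbn -[pow]; auto_derive; trivial; field.
Qed.

Lemma area2_alpha (a eps u v : R) :
  area2 (alpha a eps) u v
  = u^2 + (1 + v^2) * (4 * v^2 + (eps + a * v^2 / 2)^2).
Proof.
  unfold area2, coefE, coefF, coefG. rewrite du_alpha, dv_alpha.
  unfold dot; autorewrite with r4; ring.
Qed.

Lemma alpha_axiumbilic (a eps u v g : R) :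
  g = eps + a * v^2 / 2 -> 0 < u^2 + (1 + v^2) * (4 * v^2 + g^2) ->
  axiumbilic (alpha a eps) (u, v) <->
  (u * v * (2 * (4 * v^2 + g^2) + (4 + a * g) * (1 + v^2)) = 0 /\
   4 * (4 * v^2 + g^2) * (u^2 + 4 * v^2 + g^2)
   = (1 + v^2) * (u^2 * (4 + a^2 * v^2) + 4 * (1 + v^2) * (g - a * v^2)^2)).
Proof.
  intros Hg HD. pose proof (area2_alpha a eps u v) as HA. rewrite <- Hg in HA.
  rewrite <- HA in HD.
  assert (HD0 : area2 (alpha a eps) u v <> 0) by lra.
  assert (HE : coefE (alpha a eps) u v = 1 + v^2)
    by (unfold coefE; rewrite du_alpha; unfold dot; autorewrite with r4; ring).
  assert (HF : coefF (alpha a eps) u v = u * v)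
    by (unfold coefF; rewrite du_alpha, dv_alpha; unfold dot;
        autorewrite with r4; ring).
  assert (HG : coefG (alpha a eps) u v = u^2 + 4 * v^2 + g^2)
    by (unfold coefG; rewrite dv_alpha, <- Hg; unfold dot;
        autorewrite with r4; ring).
  pose proof (normal_dot _ _ _ (du_ (dv_ (alpha a eps)) u v)
                (du_ (dv_ (alpha a eps)) u v) HD0) as H11.
  pose proof (normal_dot _ _ _ (du_ (dv_ (alpha a eps)) u v)
                (dv_ (dv_ (alpha a eps)) u v) HD0) as H12.
  pose proof (normal_dot _ _ _ (dv_ (dv_ (alpha a eps)) u v)
                (dv_ (dv_ (alpha a eps)) u v) HD0) as H22.
  rewrite axiumbilic_iff;
    [| rewrite HE; nra | exact HD
     | unfold II11; rewrite duu_alpha; apply normal_part_zero].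
  fold (II12 (alpha a eps) u v) (II22 (alpha a eps) u v) in H11, H12, H22.
  rewrite duv_alpha in H11, H12. rewrite dvv_alpha in H12, H22.
  rewrite HE, HF, HG, du_alpha, dv_alpha, <- Hg in H11, H12, H22.
  rewrite HE, HF, HG.
  set (m11 := dot (II12 _ _ _) (II12 _ _ _)) in *.
  set (m12 := dot (II12 _ _ _) (II22 _ _ _)) in *.
  set (m22 := dot (II22 _ _ _) (II22 _ _ _)) in *.
  set (D := area2 (alpha a eps) u v) in *.
  clearbody m11 m12 m22 D.
  unfold dot in H11, H12, H22. autorewrite with r4 in H11, H12, H22.
  assert (K11 : D * m11 = 4 * v^2 + g^2) by (rewrite H11, HA; ring).
  assert (K12 : D * m12 = - (u * v * (4 + a * g))) by (rewrite H12, HA; ring).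
  assert (K22 : D * m22 = u^2 * (4 + a^2 * v^2) + 4 * (1 + v^2) * (g - a * v^2)^2)
    by (rewrite H22, HA; ring).
  rewrite <- K22.
  assert (Z1 : D * ((1 + v^2) * m12) = - (u * v * (4 + a * g)) * (1 + v^2))
    by (rewrite <- K12; ring).
  assert (Z2 : D * (2 * (u * v) * m11) = 2 * (u * v) * (4 * v^2 + g^2))
    by (rewrite <- K11; ring).
  assert (Z3 : D * (4 * (u^2 + 4 * v^2 + g^2) * m11)
    = 4 * (4 * v^2 + g^2) * (u^2 + 4 * v^2 + g^2)) by (rewrite <- K11; ring).
  split; intros [A1 A2].
  - split.
    + apply (f_equal (Rmult D)) in A1. rewrite Z1, Z2 in A1. lra.
    + rewrite <- Z3, <- A2. ring.
  - split.
    + apply (Rmult_eq_reg_l D); [|exact HD0]. rewrite Z1, Z2. lra.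
    + apply (Rmult_eq_reg_l D); [|exact HD0]. rewrite Z3, A2. ring.
Qed.

(* The sign [sigma] records which of the two factors of the second equation
   vanishes at [u = 0]. *)
Lemma alpha_axiumbilic_small (a eps u v g : R) :
  g = eps + a * v^2 / 2 -> eps <> 0 -> Rabs eps < 1 ->
  0 < 2 * (4 * v^2 + g^2) + (4 + a * g) * (1 + v^2) ->
  axiumbilic (alpha a eps) (u, v) <->
  (u = 0 /\ exists sigma, (sigma = 1 \/ sigma = -1) /\
     4 * v^2 + g^2 = sigma * (1 + v^2) * (g - a * v^2)).
Proof.
  intros Hg He He1 Hb.
  assert (HW : 0 < 4 * v^2 + g^2).
  { destruct (Req_dec v 0) as [->|Hv]; [|nra].
    assert (g = eps) by (rewrite Hg; field). nra. }
  rewrite (alpha_axiumbilic a eps u v g Hg) by nra.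
  apply Rabs_def2 in He1.
  split.
  - intros [H1 H2].
    assert (Hu : u = 0).
    { apply Rmult_integral in H1. destruct H1 as [H1|H1]; [|lra].
      apply Rmult_integral in H1. destruct H1 as [H1|H1]; [exact H1|].
      subst v. assert (g = eps) by (rewrite Hg; field).
      assert (Hz : (u^2 + eps^2) * (1 - eps^2) = 0) by (subst g; lra).
      apply Rmult_integral in Hz. destruct Hz; nra. }
    split; [exact Hu|]. subst u.
    assert (Hz : (4 * v^2 + g^2 - (1 + v^2) * (g - a * v^2))
                 * (4 * v^2 + g^2 + (1 + v^2) * (g - a * v^2)) = 0) by lra.
    apply Rmult_integral in Hz. destruct Hz as [Hz|Hz].
    + exists 1. split; [now left | lra].
    + exists (-1). split; [now right | lra].
  - intros (-> & sigma & Hs & H). split; [ring|].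
    assert (Hs2 : sigma^2 = 1) by (destruct Hs; subst; ring).
    transitivity (4 * (4 * v^2 + g^2)^2); [ring|].
    rewrite H.
    transitivity (4 * sigma^2 * ((1 + v^2) * (g - a * v^2))^2); [ring|].
    rewrite Hs2; ring.
Qed.

Definition branch (b e w : R) : Prop :=
  4 * w + (e + b * w / 2)^2 = (1 + w) * (e - b * w / 2).

Lemma branch_quadratic (b e w : R) :
  branch b e w <->
  b * (b + 2) / 4 * w^2 + ((8 + b) / 2 + e * (b - 1)) * w = e * (1 - e).
Proof. unfold branch; split; intros H; lra. Qed.

Lemma quadratic_root_exists (A B t eta : R) :
  0 < eta -> 0 < t -> t < A * eta^2 + B * eta ->
  exists w, 0 < w < eta /\ A * w^2 + B * w = t.
Proof.
  intros He Ht H.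
  destruct (IVT_interv (fun w => A * w^2 + B * w - t) 0 eta) as (w & Hw & Hr).
  - intros w _. reg.
  - exact He.
  - nra.
  - lra.
  - exists w. split; [|lra].
    destruct (Req_dec w 0) as [->|]; [lra|].
    destruct (Req_dec w eta) as [->|]; lra.
Qed.

Lemma quadratic_root_unique (A B t eta c w w' : R) :
  Rabs A * eta <= c / 4 -> c <= B -> 0 < c ->
  0 <= w < eta -> 0 <= w' < eta ->
  A * w^2 + B * w = t -> A * w'^2 + B * w' = t -> w' = w.
Proof.
  intros HA HB Hc Hw Hw' H H'.
  assert (Hz : (w - w') * (A * (w + w') + B) = 0) by lra.
  apply Rmult_integral in Hz. destruct Hz as [Hz|Hz]; [lra|].
  pose proof (Rle_abs (- A)) as HN. rewrite Rabs_Ropp in HN.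
  pose proof (Rabs_pos A). nra.
Qed.

Lemma quadratic_nonneg (A B eta c w : R) :
  Rabs A * eta <= c / 4 -> c <= B -> 0 < c -> 0 <= w <= eta ->
  c / 2 * w <= A * w^2 + B * w.
Proof.
  intros HA HB Hc Hw.
  pose proof (Rle_abs (- A)) as HN. rewrite Rabs_Ropp in HN.
  pose proof (Rabs_pos A).
  assert (- (c / 4) <= A * w) by nra.
  nra.
Qed.

(* For [b = -8] the linear coefficient of [branch_quadratic] vanishes with [e],
   so the root is of order [sqrt e] instead of [e]. *)
Lemma branch_small_roots (b : R) :
  exists eta0, 0 < eta0 /\ forall eta, 0 < eta <= eta0 ->
  exists e0, 0 < e0 /\ forall e, e <> 0 -> Rabs e < e0 ->
    ((-8 <= b /\ 0 < e) \/ (b < -8 /\ e < 0) ->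
       exists w, 0 < w < eta /\ branch b e w /\
         forall w', 0 <= w' < eta -> branch b e w' -> w' = w) /\
    ((-8 <= b /\ e < 0) \/ (b < -8 /\ 0 < e) ->
       forall w, 0 <= w < eta -> ~ branch b e w).
Proof.
  destruct (Req_dec b (-8)) as [->|Hb].
  - exists 1. split; [lra|]. intros eta Heta.
    exists (Rmin (1/2) (eta^2 / 2)). split; [apply Rmin_pos; nra|].
    intros e He0 He.
    assert (He1 : Rabs e < 1/2)
      by (eapply Rlt_le_trans; [exact He | apply Rmin_l]).
    assert (He2 : Rabs e < eta^2 / 2)
      by (eapply Rlt_le_trans; [exact He | apply Rmin_r]).
    apply Rabs_def2 in He1. apply Rabs_def2 in He2. clear He.
    split; [intros [[_ He]|[? _]] | intros [[_ He]|[? _]]]; try lra.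
    + destruct (quadratic_root_exists 12 (- 9 * e) (e * (1 - e)) eta)
        as (w & Hw & Hr); [lra | nra | nra |].
      exists w. split; [exact Hw|]. split; [apply branch_quadratic; lra|].
      intros w' Hw' Hr'. apply branch_quadratic in Hr'.
      assert (Hz : (w - w') * (12 * (w + w') - 9 * e) = 0) by lra.
      apply Rmult_integral in Hz. destruct Hz as [Hz|Hz]; [lra|].
      assert (12 * (w * w') = - (e * (1 - e))).
      { replace (12 * (w * w')) with (w * (12 * (w + w')) - 12 * w^2) by ring.
        replace (12 * (w + w')) with (9 * e) by lra. lra. }
      assert (0 <= w * w') by nra. nra.
    + intros w Hw Hr. apply branch_quadratic in Hr. nra.
  - set (s := if Rlt_dec b (-8) then -1 else 1).
    assert (Hs : s = 1 /\ -8 < b \/ s = -1 /\ b < -8).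
    { unfold s. destruct (Rlt_dec b (-8)); [right|left]; split; lra. }
    clearbody s.
    set (c := s * (8 + b) / 4).
    assert (Hc : 0 < c) by (unfold c; destruct Hs as [[-> ?]|[-> ?]]; lra).
    set (A := s * (b * (b + 2) / 4)).
    pose proof (Rabs_pos A) as HA0. pose proof (Rabs_pos (b - 1)) as Hb0.
    exists (c / (4 * (Rabs A + 1))). split; [apply Rdiv_lt_0_compat; lra|].
    intros eta Heta.
    assert (HAe : Rabs A * eta <= c / 4).
    { transitivity ((Rabs A + 1) * eta); [nra|].
      transitivity ((Rabs A + 1) * (c / (4 * (Rabs A + 1)))); [nra|].
      right; field; lra. }
    exists (Rmin (1/2) (Rmin (c * eta / 4) (c / (Rabs (b - 1) + 1)))).
    assert (0 < c / (Rabs (b - 1) + 1)) by (apply Rdiv_lt_0_compat; lra).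
    split; [repeat apply Rmin_pos; nra|].
    intros e He0 He.
    assert (He1 : Rabs e < 1/2)
      by (eapply Rlt_le_trans; [exact He | apply Rmin_l]).
    assert (He23 : Rabs e < Rmin (c * eta / 4) (c / (Rabs (b - 1) + 1)))
      by (eapply Rlt_le_trans; [exact He | apply Rmin_r]).
    assert (He2 : Rabs e < c * eta / 4)
      by (eapply Rlt_le_trans; [exact He23 | apply Rmin_l]).
    assert (He3 : Rabs e < c / (Rabs (b - 1) + 1))
      by (eapply Rlt_le_trans; [exact He23 | apply Rmin_r]).
    clear He He23.
    set (B := s * ((8 + b) / 2 + e * (b - 1))).
    assert (HB : c <= B).
    { assert (Hsb : Rabs (s * (e * (b - 1))) <= c).
      { assert (Rabs s = 1)
          by (destruct Hs as [[-> _]|[-> _]]; rewrite ?Rabs_Ropp;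
              [apply Rabs_R1 | rewrite Rabs_left; lra]).
        rewrite !Rabs_mult, H0, Rmult_1_l.
        transitivity (c / (Rabs (b - 1) + 1) * (Rabs (b - 1) + 1)).
        - pose proof (Rabs_pos e). nra.
        - right; field; lra. }
      apply Rabs_le_between in Hsb. unfold B, c in *. lra. }
    assert (Hq : forall w, branch b e w <-> A * w^2 + B * w = s * (e * (1 - e))).
    { intros w. rewrite branch_quadratic. unfold A, B.
      destruct Hs as [[-> _]|[-> _]]; split; intros; lra. }
    apply Rabs_def2 in He1.
    assert (Hse : forall x, 0 < s * e -> s * e = x -> 0 < s * (e * (1 - e)) < 2 * x).
    { intros x Hx <-. nra. }
    assert (Hsl : s * e < c * eta / 4).
    { apply Rabs_def2 in He2. destruct Hs as [[-> _]|[-> _]]; lra. }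
    split.
    + intros Hcase.
      assert (Hpos : 0 < s * e) by (destruct Hs as [[-> ?]|[-> ?]]; lra).
      destruct (Hse _ Hpos eq_refl) as [Ht1 Ht2].
      pose proof (quadratic_nonneg A B eta c eta HAe HB Hc ltac:(lra)).
      destruct (quadratic_root_exists A B (s * (e * (1 - e))) eta)
        as (w & Hw & Hr); [lra | lra | lra |].
      exists w. split; [exact Hw|]. split; [apply Hq; exact Hr|].
      intros w' Hw' Hr'. apply Hq in Hr'.
      apply (quadratic_root_unique A B (s * (e * (1 - e))) eta c); lra.
    + intros Hcase w Hw Hr. apply Hq in Hr.
      assert (Hneg : s * e < 0) by (destruct Hs as [[-> ?]|[-> ?]]; lra).
      pose proof (quadratic_nonneg A B eta c w HAe HB Hc ltac:(lra)).
      assert (s * (e * (1 - e)) < 0) by nra.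
      nra.
Qed.

(** * First-order jets at the origin *)

Definition near (P : R -> R -> Prop) : Prop :=
  locally (0, 0) (fun z : R * R => P (fst z) (snd z)).

Lemma near_imp (P Q : R -> R -> Prop) :
  (forall x y, P x y -> Q x y) -> near P -> near Q.
Proof. intros H. unfold near. apply filter_imp. intros [x y]. apply H. Qed.

Lemma near_forall (P : R -> R -> Prop) : (forall x y, P x y) -> near P.
Proof. intros H. unfold near. apply filter_forall. intros [x y]. apply H. Qed.

Lemma near_and (P Q : R -> R -> Prop) :
  near P -> near Q -> near (fun x y => P x y /\ Q x y).
Proof. unfold near. apply filter_and. Qed.

Lemma near_fst (P : R -> Prop) : locally 0 P -> near (fun x _ => P x).
Proof. intros [d H]. exists d. intros [x y] [Hx _]. apply H, Hx. Qed.

Lemma near_box (d : R) : 0 < d -> near (fun x y => Rabs x < d /\ Rabs y < d).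
Proof.
  intros Hd. exists (mkposreal d Hd). intros [x y] [Hx Hy].
  change (Rabs (x - 0) < d) in Hx. change (Rabs (y - 0) < d) in Hy.
  simpl. rewrite Rminus_0_r in Hx, Hy. auto.
Qed.

Definition O2 (f : R -> R -> R) : Prop :=
  exists C, 0 <= C /\ near (fun x y => Rabs (f x y) <= C * (x^2 + y^2)).

Definition bounded_near (f : R -> R -> R) : Prop :=
  exists M, 0 <= M /\ near (fun x y => Rabs (f x y) <= M).

Lemma O2_ext (f g : R -> R -> R) :
  near (fun x y => f x y = g x y) -> O2 f -> O2 g.
Proof.
  intros H (C & HC & HF). exists C. split; [exact HC|].
  generalize (near_and _ _ H HF). apply near_imp. intros x y [<- ?]. assumption.
Qed.

Lemma O2_plus (f g : R -> R -> R) :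
  O2 f -> O2 g -> O2 (fun x y => f x y + g x y).
Proof.
  intros (C & HC & HF) (C' & HC' & HG). exists (C + C'). split; [lra|].
  generalize (near_and _ _ HF HG). apply near_imp. intros x y [? ?].
  eapply Rle_trans; [apply Rabs_triang|]. lra.
Qed.

Lemma O2_mult (f g : R -> R -> R) :
  O2 f -> bounded_near g -> O2 (fun x y => f x y * g x y).
Proof.
  intros (C & HC & HF) (M & HM & HG). exists (C * M). split; [nra|].
  generalize (near_and _ _ HF HG). apply near_imp. intros x y [H1 H2].
  rewrite Rabs_mult. pose proof (Rabs_pos (f x y)). pose proof (Rabs_pos (g x y)).
  replace (C * M * (x^2 + y^2)) with (C * (x^2 + y^2) * M) by ring.
  apply Rmult_le_compat; assumption.
Qed.

Lemma O2_quadratic (p q r : R) : O2 (fun x y => p * x^2 + q * (x * y) + r * y^2).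
Proof.
  exists (Rabs p + Rabs q + Rabs r).
  pose proof (Rabs_pos p). pose proof (Rabs_pos q). pose proof (Rabs_pos r).
  split; [lra|]. apply near_forall. intros x y.
  assert (H2 : Rabs (x * y) <= x^2 + y^2) by (apply Rabs_le; nra).
  assert (Hx : Rabs (x^2) = x^2) by (apply Rabs_pos_eq; nra).
  assert (Hy : Rabs (y^2) = y^2) by (apply Rabs_pos_eq; nra).
  eapply Rle_trans; [apply Rabs_triang|].
  eapply Rle_trans; [apply Rplus_le_compat_r, Rabs_triang|].
  rewrite !Rabs_mult, Hx, Hy. rewrite Rabs_mult in H2.
  nra.
Qed.

Lemma bounded_linear (p q r : R) : bounded_near (fun x y => p + q * x + r * y).
Proof.
  exists (Rabs p + Rabs q + Rabs r).
  pose proof (Rabs_pos p). pose proof (Rabs_pos q). pose proof (Rabs_pos r).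
  split; [lra|]. generalize (near_box 1 Rlt_0_1). apply near_imp.
  intros x y [Hx Hy].
  eapply Rle_trans; [apply Rabs_triang|].
  eapply Rle_trans; [apply Rplus_le_compat_r, Rabs_triang|].
  rewrite !Rabs_mult. nra.
Qed.

Lemma O2_bounded (f : R -> R -> R) : O2 f -> bounded_near f.
Proof.
  intros (C & HC & HF). exists (C * 2). split; [lra|].
  generalize (near_and _ _ (near_box 1 Rlt_0_1) HF). apply near_imp.
  intros x y [[Hx Hy] H]. apply Rabs_def2 in Hx. apply Rabs_def2 in Hy.
  assert (x^2 + y^2 <= 2) by nra. nra.
Qed.

Lemma bounded_plus (f g : R -> R -> R) :
  bounded_near f -> bounded_near g -> bounded_near (fun x y => f x y + g x y).
Proof.
  intros (C & HC & HF) (C' & HC' & HG). exists (C + C'). split; [lra|].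
  generalize (near_and _ _ HF HG). apply near_imp. intros x y [? ?].
  eapply Rle_trans; [apply Rabs_triang|]. lra.
Qed.

Definition jet (f : R -> R -> R) (c0 c1 c2 : R) : Prop :=
  O2 (fun x y => f x y - (c0 + c1 * x + c2 * y)).

Lemma jet_eq (f : R -> R -> R) (c0 c1 c2 d0 d1 d2 : R) :
  jet f c0 c1 c2 -> c0 = d0 -> c1 = d1 -> c2 = d2 -> jet f d0 d1 d2.
Proof. intros H <- <- <-. exact H. Qed.

Lemma jet_ext (f g : R -> R -> R) (c0 c1 c2 : R) :
  near (fun x y => f x y = g x y) -> jet f c0 c1 c2 -> jet g c0 c1 c2.
Proof.
  intros H. apply O2_ext. revert H. apply near_imp. intros x y ->. reflexivity.
Qed.

Lemma O2_zero : O2 (fun _ _ => 0).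
Proof.
  exists 0. split; [lra|]. apply near_forall. intros x y. rewrite Rabs_R0. lra.
Qed.

Lemma jet_linear (c0 c1 c2 : R) : jet (fun x y => c0 + c1 * x + c2 * y) c0 c1 c2.
Proof.
  apply O2_ext with (2 := O2_zero). apply near_forall. intros; ring.
Qed.

Lemma jet_const (c : R) : jet (fun _ _ => c) c 0 0.
Proof.
  apply (jet_ext (fun x y => c + 0 * x + 0 * y)); [|apply jet_linear].
  apply near_forall. intros; ring.
Qed.

Lemma jet_x : jet (fun x _ => x) 0 1 0.
Proof.
  apply (jet_ext (fun x y => 0 + 1 * x + 0 * y)); [|apply jet_linear].
  apply near_forall. intros; ring.
Qed.

Lemma jet_y : jet (fun _ y => y) 0 0 1.
Proof.
  apply (jet_ext (fun x y => 0 + 0 * x + 1 * y)); [|apply jet_linear].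
  apply near_forall. intros; ring.
Qed.

Lemma jet_plus (f g : R -> R -> R) (c0 c1 c2 d0 d1 d2 : R) :
  jet f c0 c1 c2 -> jet g d0 d1 d2 ->
  jet (fun x y => f x y + g x y) (c0 + d0) (c1 + d1) (c2 + d2).
Proof.
  intros H K. apply O2_ext with (2 := O2_plus _ _ H K).
  apply near_forall. intros; ring.
Qed.

Lemma jet_bounded (f : R -> R -> R) (c0 c1 c2 : R) :
  jet f c0 c1 c2 -> bounded_near f.
Proof.
  intros H. destruct (bounded_plus _ _ (O2_bounded _ H) (bounded_linear c0 c1 c2))
    as (M & HM & K).
  exists M. split; [exact HM|]. revert K. apply near_imp. intros x y.
  replace (f x y - (c0 + c1 * x + c2 * y) + (c0 + c1 * x + c2 * y))
    with (f x y) by ring. trivial.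
Qed.

Lemma jet_mult (f g : R -> R -> R) (c0 c1 c2 d0 d1 d2 : R) :
  jet f c0 c1 c2 -> jet g d0 d1 d2 ->
  jet (fun x y => f x y * g x y)
    (c0 * d0) (c0 * d1 + c1 * d0) (c0 * d2 + c2 * d0).
Proof.
  intros H K.
  apply O2_ext with (2 := O2_plus _ _
    (O2_plus _ _ (O2_mult _ _ H (jet_bounded _ _ _ _ K))
                 (O2_mult _ _ K (bounded_linear c0 c1 c2)))
    (O2_quadratic (c1 * d1) (c1 * d2 + c2 * d1) (c2 * d2))).
  apply near_forall. intros; ring.
Qed.

Lemma jet_opp (f : R -> R -> R) (c0 c1 c2 : R) :
  jet f c0 c1 c2 -> jet (fun x y => - f x y) (- c0) (- c1) (- c2).
Proof.
  intros H. eapply jet_eq.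
  - apply (jet_ext (fun x y => -1 * f x y)).
    + apply near_forall. intros; ring.
    + apply jet_mult; [apply jet_const | exact H].
  - ring.
  - ring.
  - ring.
Qed.

Lemma jet_minus (f g : R -> R -> R) (c0 c1 c2 d0 d1 d2 : R) :
  jet f c0 c1 c2 -> jet g d0 d1 d2 ->
  jet (fun x y => f x y - g x y) (c0 - d0) (c1 - d1) (c2 - d2).
Proof. intros H K. apply jet_plus; [exact H | apply jet_opp, K]. Qed.

Lemma jet_sqr (f : R -> R -> R) (c0 c1 c2 : R) :
  jet f c0 c1 c2 ->
  jet (fun x y => f x y ^ 2) (c0 ^ 2) (2 * c0 * c1) (2 * c0 * c2).
Proof.
  intros H. eapply jet_eq.
  - apply (jet_ext (fun x y => f x y * f x y)).
    + apply near_forall. intros; ring.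
    + apply jet_mult; exact H.
  - ring.
  - ring.
  - ring.
Qed.

Lemma jet_close (f : R -> R -> R) (c0 c1 c2 e : R) :
  jet f c0 c1 c2 -> 0 < e -> near (fun x y => Rabs (f x y - c0) < e).
Proof.
  intros (C & HC & H) He.
  set (m := C + 1 + Rabs c1 + Rabs c2).
  assert (Hm : 0 < m)
    by (unfold m; pose proof (Rabs_pos c1); pose proof (Rabs_pos c2); lra).
  assert (Hd : 0 < Rmin 1 (e / (2 * m)))
    by (apply Rmin_pos; [lra | apply Rdiv_lt_0_compat; lra]).
  generalize (near_and _ _ (near_box _ Hd) H). apply near_imp.
  intros x y [[Hx Hy] K]. set (d := Rmin 1 (e / (2 * m))) in *.
  assert (d <= 1) by apply Rmin_l.
  assert (Hdm : 2 * (m * d) <= e).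
  { assert (Hr : d <= e / (2 * m)) by apply Rmin_r.
    apply (Rmult_le_compat_r (2 * m)) in Hr; [|lra].
    replace (e / (2 * m) * (2 * m)) with e in Hr by (field; lra). lra. }
  assert (x^2 <= d).
  { rewrite <- (pow2_abs x). pose proof (Rabs_pos x). nra. }
  assert (y^2 <= d).
  { rewrite <- (pow2_abs y). pose proof (Rabs_pos y). nra. }
  replace (f x y - c0)
    with (f x y - (c0 + c1 * x + c2 * y) + (c1 * x + c2 * y)) by ring.
  eapply Rle_lt_trans; [apply Rabs_triang|].
  eapply Rle_lt_trans; [apply Rplus_le_compat_l, Rabs_triang|].
  rewrite !Rabs_mult.
  pose proof (Rabs_pos c1); pose proof (Rabs_pos c2).
  assert (Rabs c1 * Rabs x <= Rabs c1 * d) by nra.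
  assert (Rabs c2 * Rabs y <= Rabs c2 * d) by nra.
  assert (C * (x^2 + y^2) <= C * (2 * d)) by nra.
  assert (0 <= d * (Rabs c1 + Rabs c2)) by nra.
  unfold m in Hdm. nra.
Qed.

Lemma jet_inv (f : R -> R -> R) (c0 c1 c2 : R) :
  c0 <> 0 -> jet f c0 c1 c2 ->
  jet (fun x y => / f x y) (/ c0) (- c1 / c0 ^ 2) (- c2 / c0 ^ 2).
Proof.
  intros Hc H.
  assert (Ha : 0 < Rabs c0 / 2) by (pose proof (Rabs_pos_lt c0 Hc); lra).
  assert (Hn : near (fun x y => Rabs c0 / 2 <= Rabs (f x y))).
  { generalize (jet_close _ _ _ _ _ H Ha). apply near_imp. intros x y K.
    rewrite Rabs_minus_sym in K.
    pose proof (Rabs_triang_inv c0 (c0 - f x y)) as T.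
    replace (c0 - (c0 - f x y)) with (f x y) in T by ring. lra. }
  assert (Hb : bounded_near (fun x y => / (c0 ^ 2 * f x y))).
  { exists (/ (c0 ^ 2 * (Rabs c0 / 2))).
    assert (0 < c0 ^ 2) by nra.
    split; [apply Rlt_le, Rinv_0_lt_compat; nra|].
    revert Hn. apply near_imp. intros x y K.
    rewrite Rabs_inv, Rabs_mult, (Rabs_pos_eq (c0 ^ 2)) by nra.
    apply Rinv_le_contravar; nra. }
  assert (Hnum : O2 (fun x y =>
    c1 ^ 2 * x ^ 2 + 2 * c1 * c2 * (x * y) + c2 ^ 2 * y ^ 2
    + (f x y - (c0 + c1 * x + c2 * y)) * (- c0 + c1 * x + c2 * y))).
  { apply O2_plus; [apply O2_quadratic|].
    apply O2_mult; [exact H | apply bounded_linear]. }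
  apply O2_ext with (2 := O2_mult _ _ Hnum Hb).
  revert Hn. apply near_imp. intros x y K.
  assert (f x y <> 0) by (intros E; rewrite E, Rabs_R0 in K; lra).
  field. auto.
Qed.

Lemma jet_div (f g : R -> R -> R) (c0 c1 c2 d0 d1 d2 : R) :
  d0 <> 0 -> jet f c0 c1 c2 -> jet g d0 d1 d2 ->
  jet (fun x y => f x y / g x y)
    (c0 / d0) ((c1 * d0 - c0 * d1) / d0 ^ 2) ((c2 * d0 - c0 * d2) / d0 ^ 2).
Proof.
  intros Hd H K. eapply jet_eq;
    [apply (jet_mult _ _ _ _ _ _ _ _ H (jet_inv _ _ _ _ Hd K)) | | |];
    field; exact Hd.
Qed.

Lemma jet_of_derive (f g : R -> R) (c : R) :
  locally 0 (fun x => is_derive f x (g x)) -> is_derive g 0 c ->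
  jet (fun x _ => f x) (f 0) (g 0) 0.
Proof.
  intros Hf Hg.
  assert (Hl : locally 0 (fun x => Rabs (g x - g 0) <= (Rabs c + 1) * Rabs x)).
  { apply is_derive_Reals in Hg. destruct (Hg 1 Rlt_0_1) as [d Hd].
    exists d. intros x Hx. change (Rabs (x - 0) < d) in Hx.
    rewrite Rminus_0_r in Hx.
    destruct (Req_dec x 0) as [->|Hx0].
    - rewrite Rminus_diag, Rabs_R0. lra.
    - specialize (Hd x Hx0 Hx). rewrite Rplus_0_l in Hd.
      replace (g x - g 0) with (((g x - g 0) / x - c + c) * x)
        by (field; exact Hx0).
      rewrite Rabs_mult. apply Rmult_le_compat_r; [apply Rabs_pos|].
      eapply Rle_trans; [apply Rabs_triang|]. lra. }
  destruct (filter_and _ _ Hf Hl) as [d Hd].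
  exists (Rabs c + 1). pose proof (Rabs_pos c). split; [lra|].
  exists d. intros [x y] [Hx _]; simpl fst; simpl snd.
  change (Rabs (x - 0) < d) in Hx. rewrite Rminus_0_r in Hx.
  assert (Hin : forall z, Rabs z <= Rabs x -> ball 0 d z).
  { intros z Hz. change (Rabs (z - 0) < d). rewrite Rminus_0_r. lra. }
  assert (Hmm : forall z, Rmin 0 x <= z <= Rmax 0 x -> Rabs z <= Rabs x).
  { intros z. unfold Rmin, Rmax, Rabs.
    destruct (Rle_dec 0 x), (Rcase_abs z), (Rcase_abs x); lra. }
  destruct (MVT_gen f 0 x g) as (z & Hz & E).
  - intros t Ht. apply Hd, Hin, Hmm. lra.
  - intros t Ht. apply continuity_pt_filterlim.
    apply (ex_derive_continuous (V := R_NormedModule)).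
    exists (g t). apply Hd, Hin, Hmm, Ht.
  - apply Hmm in Hz.
    replace (f x - (f 0 + g 0 * x + 0 * y)) with ((g z - g 0) * x) by lra.
    rewrite Rabs_mult. destruct (Hd z (Hin z Hz)) as [_ K].
    transitivity ((Rabs c + 1) * Rabs x * Rabs x).
    + apply Rmult_le_compat_r; [apply Rabs_pos|]. nra.
    + rewrite <- (pow2_abs x). nra.
Qed.

Lemma O2_quartic_form (d0 d1 d2 d3 d4 : R -> R -> R) :
  O2 d0 -> O2 d1 -> O2 d2 -> O2 d3 -> O2 d4 ->
  exists C, near (fun x y => forall a b,
    Rabs (d0 x y * a^4 + d1 x y * (a^3 * b) + d2 x y * (a^2 * b^2)
          + d3 x y * (a * b^3) + d4 x y * b^4)
    <= C * (x^2 + y^2) * (a^2 + b^2)^2).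
Proof.
  intros (C0 & H0 & K0) (C1 & H1 & K1) (C2 & H2 & K2) (C3 & H3 & K3) (C4 & H4 & K4).
  exists (C0 + C1 + C2 + C3 + C4).
  generalize (near_and _ _ K0 (near_and _ _ K1 (near_and _ _ K2 (near_and _ _ K3 K4)))).
  apply near_imp. intros x y (L0 & L1 & L2 & L3 & L4) a b.
  assert (Hq : 0 <= x^2 + y^2) by nra. set (n := x^2 + y^2) in *.
  assert (M0 : Rabs (a^4) <= (a^2 + b^2)^2) by (apply Rabs_le; nra).
  assert (Hab : Rabs (a * b) <= a^2 + b^2) by (apply Rabs_le; nra).
  assert (M1 : Rabs (a^3 * b) <= (a^2 + b^2)^2).
  { replace (a^3 * b) with (a^2 * (a * b)) by ring.
    rewrite Rabs_mult, (Rabs_pos_eq (a^2)) by nra. nra. }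
  assert (M2 : Rabs (a^2 * b^2) <= (a^2 + b^2)^2) by (apply Rabs_le; nra).
  assert (M3 : Rabs (a * b^3) <= (a^2 + b^2)^2).
  { replace (a * b^3) with (b^2 * (a * b)) by ring.
    rewrite Rabs_mult, (Rabs_pos_eq (b^2)) by nra. nra. }
  assert (M4 : Rabs (b^4) <= (a^2 + b^2)^2) by (apply Rabs_le; nra).
  set (q := (a^2 + b^2)^2) in *.
  assert (T : forall d m c, Rabs d <= c * n -> Rabs m <= q ->
    Rabs (d * m) <= c * n * q).
  { intros d m c Hd Hm. rewrite Rabs_mult.
    apply Rmult_le_compat; [apply Rabs_pos | apply Rabs_pos | exact Hd | exact Hm]. }
  repeat (eapply Rle_trans; [apply Rabs_triang|];
          rewrite ?Rmult_plus_distr_r; apply Rplus_le_compat); auto.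
Qed.

(** * The axial equation when II22 vanishes *)

Lemma axial_function_expand (X : R -> R -> R4) (u v a b : R) :
  II22 X u v = vec4 0 0 0 0 ->
  let n11 := dot (II11 X u v) (II11 X u v) in
  let n12 := dot (II11 X u v) (II12 X u v) in
  let n22 := dot (II12 X u v) (II12 X u v) in
  let I := first_form X u v a b in
  axial_function X u v a b
  = (n11 * a^4 + 4 * n12 * (a^3 * b) + 4 * n22 * (a^2 * b^2)) * (/ I)^2
    - 2 * ((coefG X u v * n11 - 2 * coefF X u v * n12) * a^2
           + 2 * (coefG X u v * n12 - 2 * coefF X u v * n22) * (a * b))
      * / (2 * area2 X u v) * / I
    + dot (mean_curvature X u v) (mean_curvature X u v).
Proof.
  intros H22 n11 n12 n22 I. unfold axial_function. rewrite enorm_sqr.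
  unfold normal_curvature, second_form, mean_curvature. rewrite H22.
  fold I. unfold n11, n12, n22.
  generalize (II11 X u v) (II12 X u v) (coefE X u v) (coefF X u v)
    (coefG X u v) (/ (2 * area2 X u v)) (/ I).
  intros P Q E F G d J. unfold dot. autorewrite with r4. ring.
Qed.

Lemma jacobian_rational (p0 p1 p2 q0 q1 h E F G a b : R) :
  let I := fun a b => E * a^2 + 2 * F * a * b + G * b^2 in
  let f := fun a b =>
    (p0 * a^4 + p1 * (a^3 * b) + p2 * (a^2 * b^2)) * (/ I a b)^2
    - 2 * (q0 * a^2 + q1 * (a * b)) * / I a b + h in
  I a b <> 0 ->
  (I a b)^2 * jacobian f I a b
  = (4 * p0 * a^3 + 3 * p1 * (a^2 * b) + 2 * p2 * (a * b^2))
      * (2 * F * a + 2 * G * b)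
    - (p1 * a^3 + 2 * p2 * (a^2 * b)) * (2 * E * a + 2 * F * b)
    - 2 * I a b * ((2 * q0 * a + q1 * b) * (2 * F * a + 2 * G * b)
                   - q1 * a * (2 * E * a + 2 * F * b)).
Proof.
  intros I f HI. unfold jacobian.
  set (Ia := 2 * E * a + 2 * F * b). set (Ib := 2 * F * a + 2 * G * b).
  set (P := p0 * a^4 + p1 * (a^3 * b) + p2 * (a^2 * b^2)).
  set (Q := q0 * a^2 + q1 * (a * b)).
  assert (D1 : is_derive (fun s => I s b) a Ia)
    by (unfold I, Ia; auto_derive; trivial; ring).
  assert (D2 : is_derive (fun s => I a s) b Ib)
    by (unfold I, Ib; auto_derive; trivial; ring).
  assert (D3 : is_derive (fun s => f s b) a
    ((4 * p0 * a^3 + 3 * p1 * (a^2 * b) + 2 * p2 * (a * b^2)) * (/ I a b)^2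
     - 2 * P * Ia * (/ I a b)^3
     - 2 * (2 * q0 * a + q1 * b) * / I a b + 2 * Q * Ia * (/ I a b)^2)).
  { unfold f, P, Q, Ia, I in *. auto_derive; [auto|]. field. exact HI. }
  assert (D4 : is_derive (fun s => f a s) b
    ((p1 * a^3 + 2 * p2 * (a^2 * b)) * (/ I a b)^2
     - 2 * P * Ib * (/ I a b)^3
     - 2 * (q1 * a) * / I a b + 2 * Q * Ib * (/ I a b)^2)).
  { unfold f, P, Q, Ib, I in *. auto_derive; [auto|]. field. exact HI. }
  replace (Derive (fun s => f s b) a) with
    ((4 * p0 * a^3 + 3 * p1 * (a^2 * b) + 2 * p2 * (a * b^2)) * (/ I a b)^2
     - 2 * P * Ia * (/ I a b)^3
     - 2 * (2 * q0 * a + q1 * b) * / I a b + 2 * Q * Ia * (/ I a b)^2)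
    by (symmetry; apply is_derive_unique; exact D3).
  replace (Derive (fun s => f a s) b) with
    ((p1 * a^3 + 2 * p2 * (a^2 * b)) * (/ I a b)^2
     - 2 * P * Ib * (/ I a b)^3
     - 2 * (q1 * a) * / I a b + 2 * Q * Ib * (/ I a b)^2)
    by (symmetry; apply is_derive_unique; exact D4).
  replace (Derive (fun s => I s b) a) with Ia
    by (symmetry; apply is_derive_unique; exact D1).
  replace (Derive (fun s => I a s) b) with Ib
    by (symmetry; apply is_derive_unique; exact D2).
  field. exact HI.
Qed.

Lemma jacobian_ext (f f' g g' : R -> R -> R) (a b : R) :
  (forall a b, f a b = f' a b) -> (forall a b, g a b = g' a b) ->
  jacobian f g a b = jacobian f' g' a b.
Proof.
  intros Hf Hg. unfold jacobian.
  f_equal; f_equal; apply Derive_ext; intros; auto.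
Qed.

(* [n11], [n12], [n22] stand for the inner products of [II11] and [II12];
   [c0] .. [c4] are the coefficients of [a^4] .. [b^4]. *)
Definition axial_c0 (E F G D n11 n12 n22 : R) : R :=
  8 * F * n11 - 8 * E * n12
  - 4 * E / D * (F * (G * n11 - 2 * F * n12) - E * (G * n12 - 2 * F * n22)).
Definition axial_c1 (E F G D n11 n12 n22 : R) : R :=
  8 * G * n11 + 16 * F * n12 - 16 * E * n22
  - 4 / D * (E * G * (G * n11 - 2 * F * n12)
             + 2 * F * (F * (G * n11 - 2 * F * n12) - E * (G * n12 - 2 * F * n22))).
Definition axial_c2 (E F G D n11 n12 n22 : R) : R :=
  24 * G * n12
  - 4 / D * (E * G * (G * n12 - 2 * F * n22)
             + 2 * F * G * (G * n11 - 2 * F * n12)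
             + G * (F * (G * n11 - 2 * F * n12) - E * (G * n12 - 2 * F * n22))).
Definition axial_c3 (E F G D n11 n12 n22 : R) : R :=
  16 * G * n22
  - 4 / D * (2 * F * G * (G * n12 - 2 * F * n22) + G * G * (G * n11 - 2 * F * n12)).
Definition axial_c4 (E F G D n11 n12 n22 : R) : R :=
  - (4 / D * (G * G * (G * n12 - 2 * F * n22))).

Lemma axial_jacobian_quartic (X : R -> R -> R4) (u v a b : R) :
  0 < coefE X u v -> 0 < area2 X u v -> II22 X u v = vec4 0 0 0 0 ->
  let n11 := dot (II11 X u v) (II11 X u v) in
  let n12 := dot (II11 X u v) (II12 X u v) in
  let n22 := dot (II12 X u v) (II12 X u v) in
  let E := coefE X u v in let F := coefF X u v in let G := coefG X u v in
  let D := area2 X u v in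
  (first_form X u v a b)^2 * axial_jacobian X u v a b
  = axial_c0 E F G D n11 n12 n22 * a^4
    + axial_c1 E F G D n11 n12 n22 * (a^3 * b)
    + axial_c2 E F G D n11 n12 n22 * (a^2 * b^2)
    + axial_c3 E F G D n11 n12 n22 * (a * b^3)
    + axial_c4 E F G D n11 n12 n22 * b^4.
Proof.
  intros HE HD H22 n11 n12 n22 E F G D.
  change (0 < E) in HE. change (0 < D) in HD.
  destruct (Req_dec (first_form X u v a b) 0) as [H0|H0].
  - assert (Hsq : (E * a + F * b)^2 + D * b^2 = 0).
    { transitivity (E * first_form X u v a b); [|rewrite H0; ring].
      unfold first_form, D, E, F, area2. ring. }
    assert (Hb : b = 0).
    { pose proof (pow2_ge_0 (E * a + F * b)). pose proof (pow2_ge_0 b).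
      assert (HDb : D * b^2 = 0) by (assert (0 <= D * b^2) by nra; lra).
      apply Rmult_integral in HDb. destruct HDb; [lra | nra]. }
    assert (Ha : a = 0).
    { subst b. assert (Hea : (E * a)^2 = 0) by lra.
      assert (Hz : E * a = 0) by nra.
      apply Rmult_integral in Hz. destruct Hz; [lra | assumption]. }
    rewrite H0. subst; ring.
  - unfold axial_jacobian.
    set (q0 := (G * n11 - 2 * F * n12) * / (2 * D)).
    set (q1 := 2 * (G * n12 - 2 * F * n22) * / (2 * D)).
    rewrite (jacobian_ext _ (fun a b =>
      (n11 * a^4 + 4 * n12 * (a^3 * b) + 4 * n22 * (a^2 * b^2))
        * (/ (E * a^2 + 2 * F * a * b + G * b^2))^2
      - 2 * (q0 * a^2 + q1 * (a * b)) * / (E * a^2 + 2 * F * a * b + G * b^2)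
      + dot (mean_curvature X u v) (mean_curvature X u v))
      _ (fun a b => E * a^2 + 2 * F * a * b + G * b^2)).
    + unfold first_form in *. fold E F G in H0 |- *.
      rewrite jacobian_rational by exact H0.
      unfold axial_c0, axial_c1, axial_c2, axial_c3, axial_c4, q0, q1.
      field. lra.
    + intros a' b'. rewrite axial_function_expand by exact H22.
      fold n11 n12 n22 E F G D. unfold first_form. fold E F G.
      unfold q0, q1. ring.
    + reflexivity.
Qed.

(** * Graphs (x, y, y rho(x), s(x)) *)

Ltac jet_rules :=
  repeat first
    [ eassumption
    | simple eapply jet_div | simple eapply jet_sqr
    | simple eapply jet_mult | simple eapply jet_plus | simple eapply jet_minus
    | simple eapply jet_opp | simple apply jet_const | simple apply jet_x
    | simple apply jet_y ].

Lemma graph_du (rho s : R -> R) (r1 s1 x y : R) :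
  is_derive rho x r1 -> is_derive s x s1 ->
  du_ (graph (fun x y => y * rho x) (fun x _ => s x)) x y
  = vec4 1 0 (y * r1) s1.
Proof.
  intros Hr Hs. apply DeriveR4_unique; unfold graph; cbn.
  - apply (is_derive_id x).
  - apply (is_derive_const y x).
  - apply is_derive_scal, Hr.
  - exact Hs.
Qed.

Lemma graph_dv (rho s : R -> R) (x y : R) :
  dv_ (graph (fun x y => y * rho x) (fun x _ => s x)) x y
  = vec4 0 1 (rho x) 0.
Proof.
  apply DeriveR4_unique; unfold graph; cbn; auto_derive; trivial; ring.
Qed.

Lemma graph_second_derivatives (rho rho1 s s1 : R -> R) (r2 s2 x y : R) :
  let Y := graph (fun x y => y * rho x) (fun x _ => s x) in
  locally x (fun t => is_derive rho t (rho1 t)) ->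
  locally x (fun t => is_derive s t (s1 t)) ->
  is_derive rho1 x r2 -> is_derive s1 x s2 ->
  du_ (du_ Y) x y = vec4 0 0 (y * r2) s2 /\
  du_ (dv_ Y) x y = vec4 0 0 (rho1 x) 0 /\
  dv_ (dv_ Y) x y = vec4 0 0 0 0.
Proof.
  intros Y Hr Hs Hr2 Hs2. repeat split.
  - unfold du_ at 1.
    rewrite (DeriveR4_ext_loc _ (fun t => vec4 1 0 (y * rho1 t) (s1 t))).
    + apply DeriveR4_unique; cbn.
      * apply (is_derive_const 1 x).
      * apply (is_derive_const 0 x).
      * apply is_derive_scal, Hr2.
      * exact Hs2.
    + generalize (filter_and _ _ Hr Hs). apply filter_imp.
      intros t [? ?]. apply graph_du; assumption.
  - unfold du_.
    rewrite (DeriveR4_ext _ (fun t => vec4 0 1 (rho t) 0))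
      by (intros; apply graph_dv).
    apply DeriveR4_unique; cbn.
    + apply (is_derive_const 0 x).
    + apply (is_derive_const 1 x).
    + apply locally_singleton in Hr. exact Hr.
    + apply (is_derive_const 0 x).
  - unfold dv_ at 1.
    rewrite (DeriveR4_ext _ (fun _ => vec4 0 1 (rho x) 0))
      by (intros; apply graph_dv).
    apply DeriveR4_unique; cbn; auto_derive; trivial; ring.
Qed.

Lemma graph_normal_form (rho rho1 rho2 s s1 s2 : R -> R) (r1 r2 r3 q2 q3 : R) :
  locally 0 (fun x => is_derive rho x (rho1 x)) ->
  locally 0 (fun x => is_derive rho1 x (rho2 x)) ->
  locally 0 (fun x => is_derive s x (s1 x)) ->
  locally 0 (fun x => is_derive s1 x (s2 x)) ->
  jet (fun x _ => rho x) 0 r1 0 -> jet (fun x _ => rho1 x) r1 r2 0 ->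
  jet (fun x _ => rho2 x) r2 r3 0 ->
  jet (fun x _ => s1 x) 0 q2 0 -> jet (fun x _ => s2 x) q2 q3 0 ->
  q2^2 = 4 * r1^2 -> r1 * r2 <> 0 ->
  axial_normal_form (graph (fun x y => y * rho x) (fun x _ => s x))
    (8 - 2 * q2 * q3 / (r1 * r2)) 0.
Proof.
  intros Hr Hr1 Hs Hs1 J0 J1 J2 K1 K2 Hq Hrr.
  set (Y := graph (fun x y => y * rho x) (fun x _ => s x)).
  set (E := fun x y => 1 + (y * rho1 x)^2 + s1 x^2).
  set (F := fun x y => y * rho1 x * rho x).
  set (G := fun x y : R => 1 + rho x^2).
  set (D := fun x y => E x y * G x y - F x y ^ 2).
  set (p := fun x y => y * rho1 x * (y * rho2 x) + s1 x * s2 x).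
  set (q := fun x y => rho x * (y * rho2 x)).
  set (p' := fun x y => y * rho1 x * rho1 x).
  set (q' := fun x y : R => rho x * rho1 x).
  set (n11 := fun x y => (D x y * ((y * rho2 x)^2 + s2 x^2)
    - (G x y * p x y ^ 2 - 2 * F x y * p x y * q x y + E x y * q x y ^ 2))
    / D x y).
  set (n12 := fun x y => (D x y * (y * rho2 x * rho1 x)
    - (G x y * p x y * p' x y - F x y * (p x y * q' x y + q x y * p' x y)
       + E x y * q x y * q' x y)) / D x y).
  set (n22 := fun x y => (D x y * rho1 x ^ 2
    - (G x y * p' x y ^ 2 - 2 * F x y * p' x y * q' x y + E x y * q' x y ^ 2))
    / D x y).
  assert (HDpos : forall x y, 0 < D x y) by (intros; unfold D, E, F, G; nra).
  assert (Hform : near (fun x y => forall a b,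
    (first_form Y x y a b)^2 * axial_jacobian Y x y a b
    = axial_c0 (E x y) (F x y) (G x y) (D x y) (n11 x y) (n12 x y) (n22 x y) * a^4
    + axial_c1 (E x y) (F x y) (G x y) (D x y) (n11 x y) (n12 x y) (n22 x y) * (a^3 * b)
    + axial_c2 (E x y) (F x y) (G x y) (D x y) (n11 x y) (n12 x y) (n22 x y) * (a^2 * b^2)
    + axial_c3 (E x y) (F x y) (G x y) (D x y) (n11 x y) (n12 x y) (n22 x y) * (a * b^3)
    + axial_c4 (E x y) (F x y) (G x y) (D x y) (n11 x y) (n12 x y) (n22 x y) * b^4)).
  { apply locally_locally in Hr. apply locally_locally in Hs.
    generalize (near_and _ _ (near_fst _ Hr)
      (near_and _ _ (near_fst _ Hr1)
        (near_and _ _ (near_fst _ Hs) (near_fst _ Hs1)))).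
    apply near_imp. intros x y (Lr & Lr1 & Ls & Ls1) a b.
    destruct (graph_second_derivatives rho rho1 s s1 _ _ x y Lr Ls Lr1 Ls1)
      as (Huu & Huv & Hvv).
    pose proof (graph_du rho s _ _ x y (locally_singleton _ _ Lr)
      (locally_singleton _ _ Ls)) as Hu.
    pose proof (graph_dv rho s x y) as Hv.
    fold Y in Huu, Huv, Hvv, Hu, Hv.
    assert (HE : coefE Y x y = E x y)
      by (unfold coefE; rewrite Hu; unfold dot, E; autorewrite with r4; ring).
    assert (HF : coefF Y x y = F x y)
      by (unfold coefF; rewrite Hu, Hv; unfold dot, F; autorewrite with r4; ring).
    assert (HG : coefG Y x y = G x y)
      by (unfold coefG; rewrite Hv; unfold dot, G; autorewrite with r4; ring).
    assert (HD : area2 Y x y = D x y)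
      by (unfold area2; rewrite HE, HF, HG; reflexivity).
    pose proof (HDpos x y) as HD0.
    assert (HDn : area2 Y x y <> 0) by lra.
    pose proof (normal_dot Y x y (du_ (du_ Y) x y) (du_ (du_ Y) x y) HDn) as N11.
    pose proof (normal_dot Y x y (du_ (du_ Y) x y) (du_ (dv_ Y) x y) HDn) as N12.
    pose proof (normal_dot Y x y (du_ (dv_ Y) x y) (du_ (dv_ Y) x y) HDn) as N22.
    fold (II11 Y x y) (II12 Y x y) in N11, N12, N22.
    rewrite Huu in N11, N12. rewrite Huv in N12, N22.
    rewrite HD, HE, HF, HG, Hu, Hv in N11, N12, N22.
    rewrite axial_jacobian_quartic.
    - rewrite HE, HF, HG, HD.
      replace (dot (II11 Y x y) (II11 Y x y)) with (n11 x y).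
      2: { apply (Rmult_eq_reg_l (D x y)); [|lra]. rewrite N11.
           unfold n11, p, q. unfold dot; autorewrite with r4. field. lra. }
      replace (dot (II11 Y x y) (II12 Y x y)) with (n12 x y).
      2: { apply (Rmult_eq_reg_l (D x y)); [|lra]. rewrite N12.
           unfold n12, p, q, p', q'. unfold dot; autorewrite with r4. field. lra. }
      replace (dot (II12 Y x y) (II12 Y x y)) with (n22 x y).
      2: { apply (Rmult_eq_reg_l (D x y)); [|lra]. rewrite N22.
           unfold n22, p', q'. unfold dot; autorewrite with r4. field. lra. }
      reflexivity.
    - rewrite HE. unfold E. nra.
    - rewrite HD. exact HD0.
    - unfold II22. rewrite Hvv. apply normal_part_zero. }
  assert (JE : jet E 1 0 0)
    by (eapply jet_eq; [unfold E; jet_rules | ring | ring | ring]).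
  assert (JF : jet F 0 0 0)
    by (eapply jet_eq; [unfold F; jet_rules | ring | ring | ring]).
  assert (JG : jet G 1 0 0)
    by (eapply jet_eq; [unfold G; jet_rules | ring | ring | ring]).
  assert (JD : jet D 1 0 0)
    by (eapply jet_eq; [unfold D; clearbody E F G; jet_rules | ring | ring | ring]).
  assert (Jp : jet p 0 (q2 * q2) 0)
    by (eapply jet_eq; [unfold p; jet_rules | ring | ring | ring]).
  assert (Jq : jet q 0 0 0)
    by (eapply jet_eq; [unfold q; jet_rules | ring | ring | ring]).
  assert (Jp' : jet p' 0 0 (r1 * r1))
    by (eapply jet_eq; [unfold p'; jet_rules | ring | ring | ring]).
  assert (Jq' : jet q' 0 (r1 * r1) 0)
    by (eapply jet_eq; [unfold q'; jet_rules | ring | ring | ring]).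
  clearbody E F G D p q p' q'.
  assert (H10 : 1 <> 0) by lra.
  assert (J11 : jet n11 (q2^2) (2 * q2 * q3) 0)
    by (eapply jet_eq; [unfold n11; jet_rules | field | field | field]).
  assert (J12 : jet n12 0 0 (r1 * r2))
    by (eapply jet_eq; [unfold n12; jet_rules | field | field | field]).
  assert (J22 : jet n22 (r1^2) (2 * r1 * r2) 0)
    by (eapply jet_eq; [unfold n22; jet_rules | field | field | field]).
  clearbody n11 n12 n22.
  set (r := r1 * r2) in *.
  set (k := - / (4 * r)). set (lam := 8 - 2 * q2 * q3 / r).
  assert (JC0 : jet (fun x y => k * axial_c0 (E x y) (F x y) (G x y) (D x y)
      (n11 x y) (n12 x y) (n22 x y)) 0 0 1)
    by (eapply jet_eq; [unfold axial_c0; jet_rules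
                       | field | field | unfold k; field; exact Hrr]).
  assert (JC1 : jet (fun x y => k * axial_c1 (E x y) (F x y) (G x y) (D x y)
      (n11 x y) (n12 x y) (n22 x y)) 0 lam 0).
  { eapply jet_eq; [unfold axial_c1; jet_rules | | | ].
    - rewrite Hq; unfold k; field; exact Hrr.
    - replace (2 * r1 * r2) with (2 * r) by (unfold r; ring).
      unfold lam, k; field; exact Hrr.
    - unfold k; field; exact Hrr. }
  assert (JC2 : jet (fun x y => k * axial_c2 (E x y) (F x y) (G x y) (D x y)
      (n11 x y) (n12 x y) (n22 x y)) 0 0 (-6))
    by (eapply jet_eq; [unfold axial_c2; jet_rules
                       | field | field | unfold k; field; exact Hrr]).
  assert (JC3 : jet (fun x y => k * axial_c3 (E x y) (F x y) (G x y) (D x y)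
      (n11 x y) (n12 x y) (n22 x y)) 0 (- lam) 0).
  { eapply jet_eq; [unfold axial_c3; jet_rules | | | ].
    - rewrite Hq; unfold k; field; exact Hrr.
    - replace (2 * r1 * r2) with (2 * r) by (unfold r; ring).
      unfold lam, k; field; exact Hrr.
    - unfold k; field; exact Hrr. }
  assert (JC4 : jet (fun x y => k * axial_c4 (E x y) (F x y) (G x y) (D x y)
      (n11 x y) (n12 x y) (n22 x y)) 0 0 1)
    by (eapply jet_eq; [unfold axial_c4; jet_rules
                       | field | field | unfold k; field; exact Hrr]).
  destruct (O2_quartic_form _ _ _ _ _ JC0 JC1 JC2 JC3 JC4) as [C HC].
  exists k, C. split.
  { unfold k. apply Ropp_neq_0_compat, Rinv_neq_0_compat. lra. }
  change (near (fun x y => forall a b,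
    Rabs (k * ((first_form Y x y a b)^2 * axial_jacobian Y x y a b)
          - (y * (b^4 - 6 * a^2 * b^2 + a^4)
             + (lam * x + 0 * y) * a * b * (a^2 - b^2)))
    <= C * (x^2 + y^2) * (a^2 + b^2)^2)).
  generalize (near_and _ _ Hform HC). apply near_imp.
  intros x y [Hf H] a b. rewrite Hf.
  eapply Rle_trans; [|apply (H a b)]. right. f_equal. ring.
Qed.

(** * Local inverses and smoothness *)

Lemma ex_derive_continuity_pt (f : R -> R) (x : R) :
  ex_derive f x -> continuity_pt f x.
Proof.
  intros H. apply continuity_pt_filterlim.
  apply (ex_derive_continuous (V := R_NormedModule)), H.
Qed.

Lemma local_inverse (h h' : R -> R) (v0 : R) (U : R -> Prop) :
  (forall v, is_derive h v (h' v)) -> continuity_pt h' v0 ->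
  h v0 = 0 -> 0 < h' v0 -> locally v0 U ->
  exists (d : R) (psi : R -> R), 0 < d /\ psi 0 = v0 /\
    forall x, Rabs x < d ->
      h (psi x) = x /\ 0 < h' (psi x) /\ U (psi x) /\
      is_derive psi x (/ h' (psi x)).
Proof.
  intros Hh Hc H0 Hp HU.
  set (m := h' v0 / 2). assert (Hm : 0 < m) by (unfold m; lra).
  assert (Hl : locally v0 (fun v => m < h' v /\ U v)).
  { apply filter_and; [|exact HU].
    apply continuity_pt_filterlim in Hc. apply Hc.
    exists (mkposreal m Hm). intros z Hz.
    change (Rabs (z - h' v0) < m) in Hz. apply Rabs_def2 in Hz.
    unfold m in *; lra. }
  destruct Hl as [r2 Hr2].
  set (r := r2 / 2). assert (Hr : 0 < r < r2)
    by (unfold r; pose proof (cond_pos r2); lra).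
  assert (HI : forall v, Rabs (v - v0) <= r -> m < h' v /\ U v).
  { intros v Hv. apply Hr2. change (Rabs (v - v0) < r2). lra. }
  assert (Hinc : forall v w, Rabs (v - v0) <= r -> Rabs (w - v0) <= r ->
    m * Rabs (w - v) <= Rabs (h w - h v)).
  { intros v w Hv Hw. apply Rabs_le_between in Hv. apply Rabs_le_between in Hw.
    destruct (MVT_gen h v w h') as (c & Hcb & E).
    - intros; apply Hh.
    - intros x _. apply ex_derive_continuity_pt. exists (h' x). apply Hh.
    - rewrite E, Rabs_mult. apply Rmult_le_compat_r; [apply Rabs_pos|].
      assert (Hcr : Rabs (c - v0) <= r).
      { apply Rabs_le. revert Hcb. unfold Rmin, Rmax.
        destruct (Rle_dec v w); lra. }
      destruct (HI c Hcr) as [Hc1 _]. rewrite Rabs_pos_eq; lra. }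
  assert (Hends : h (v0 - r) <= - (m * r) /\ m * r <= h (v0 + r)).
  { split.
    - destruct (MVT_gen h (v0 - r) v0 h') as (c & Hcb & E).
      + intros; apply Hh.
      + intros x _. apply ex_derive_continuity_pt. exists (h' x). apply Hh.
      + rewrite Rmin_left, Rmax_right in Hcb by lra.
        assert (Hcr : Rabs (c - v0) <= r) by (apply Rabs_le; lra).
        destruct (HI c Hcr) as [Hc1 _]. rewrite H0 in E. nra.
    - destruct (MVT_gen h v0 (v0 + r) h') as (c & Hcb & E).
      + intros; apply Hh.
      + intros x _. apply ex_derive_continuity_pt. exists (h' x). apply Hh.
      + rewrite Rmin_left, Rmax_right in Hcb by lra.
        assert (Hcr : Rabs (c - v0) <= r) by (apply Rabs_le; lra).
        destruct (HI c Hcr) as [Hc1 _]. rewrite H0 in E. nra. }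
  set (d := m * r). assert (Hd : 0 < d) by (unfold d; nra).
  assert (Hsol : forall x, {z | Rabs x < d -> Rabs (z - v0) <= r /\ h z = x}).
  { intros x. destruct (Rlt_dec (Rabs x) d) as [Hx|Hx].
    - apply Rabs_def2 in Hx.
      destruct (IVT_interv (fun v => h v - x) (v0 - r) (v0 + r)) as (z & Hz & E).
      + intros v _. apply ex_derive_continuity_pt.
        exists (h' v - 0). apply (is_derive_minus (V := R_NormedModule) h);
          [apply Hh | apply (is_derive_const (V := R_NormedModule))].
      + lra.
      + unfold d in *; lra.
      + unfold d in *; lra.
      + exists z. intros _. split; [apply Rabs_le; lra | lra].
    - exists 0. intros H; contradiction. }
  set (psi := fun x => proj1_sig (Hsol x)).
  assert (Hpsi : forall x, Rabs x < d -> Rabs (psi x - v0) <= r /\ h (psi x) = x)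
    by (intros x; apply (proj2_sig (Hsol x))).
  assert (Hcont : forall x, Rabs x < d -> continuity_pt psi x).
  { intros x Hx e He. exists (Rmin (d - Rabs x) (m * e)).
    split; [apply Rmin_pos; nra|].
    intros x' [_ Hx']. unfold dist in *; simpl in *; unfold Rdist in *.
    assert (L1 : Rabs (x' - x) < d - Rabs x)
      by (eapply Rlt_le_trans; [exact Hx' | apply Rmin_l]).
    assert (L2 : Rabs (x' - x) < m * e)
      by (eapply Rlt_le_trans; [exact Hx' | apply Rmin_r]).
    assert (Hx'd : Rabs x' < d).
    { replace x' with (x' - x + x) by ring.
      eapply Rle_lt_trans; [apply Rabs_triang|]. lra. }
    destruct (Hpsi x Hx) as [P1 P2]. destruct (Hpsi x' Hx'd) as [P1' P2'].
    pose proof (Hinc _ _ P1 P1') as K. rewrite P2, P2' in K. nra. }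
  exists d, psi. split; [exact Hd|].
  assert (Hz : Rabs 0 < d) by (rewrite Rabs_R0; exact Hd).
  split.
  - destruct (Hpsi 0 Hz) as [P1 P2].
    assert (Q1 : Rabs (v0 - v0) <= r) by (rewrite Rminus_diag, Rabs_R0; lra).
    pose proof (Hinc _ _ Q1 P1) as K. rewrite P2, H0, Rminus_diag, Rabs_R0 in K.
    assert (Rabs (psi 0 - v0) = 0) by (pose proof (Rabs_pos (psi 0 - v0)); nra).
    apply Rabs_eq_0 in H. lra.
  - intros x Hx. destruct (Hpsi x Hx) as [P1 P2]. destruct (HI _ P1) as [P3 P4].
    split; [exact P2|]. split; [lra|]. split; [exact P4|].
    apply is_derive_Reals.
    assert (Prf : forall v, derivable_pt h v)
      by (intros v; exists (h' v); apply is_derive_Reals, Hh).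
    set (t := (d - Rabs x) / 2).
    assert (Ht : 0 < t) by (unfold t; lra).
    assert (Hin : forall y, x - t <= y <= x + t -> Rabs y < d).
    { intros y Hy. unfold t in Hy.
      pose proof (Rabs_pos x). apply Rabs_def1;
        unfold Rabs in *; destruct (Rcase_abs x); lra. }
    assert (Hmono : forall y y', x - t <= y <= x + t -> x - t <= y' <= x + t ->
      y <= y' -> psi y <= psi y').
    { intros y y' Hy Hy' Hyy. destruct (Rle_dec (psi y) (psi y')) as [|Hn];
        [assumption|exfalso].
      destruct (Hpsi y (Hin y Hy)) as [A1 A2].
      destruct (Hpsi y' (Hin y' Hy')) as [B1 B2].
      destruct (MVT_gen h (psi y') (psi y) h') as (c & Hcb & E).
      - intros; apply Hh.
      - intros z _. apply ex_derive_continuity_pt. exists (h' z). apply Hh.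
      - rewrite Rmin_left, Rmax_right in Hcb by lra.
        apply Rabs_le_between in A1. apply Rabs_le_between in B1.
        assert (Hcr : Rabs (c - v0) <= r) by (apply Rabs_le; lra).
        destruct (HI c Hcr) as [Hc1 _]. nra. }
    assert (Hb : psi (x - t) <= psi x <= psi (x + t))
      by (split; apply Hmono; lra).
    pose proof (derivable_pt_lim_recip_interv h psi (x - t) (x + t) x
      (fun v _ => Prf v) (Hcont x Hx) ltac:(lra) ltac:(lra) Hb) as K.
    simpl in K.
    assert (Hder : derive_pt h (psi x) (Prf (psi x)) = h' (psi x))
      by (apply derive_pt_eq_0, is_derive_Reals, Hh).
    rewrite Hder in K.
    unfold Rdiv in K. rewrite Rmult_1_l in K. apply K.
    + intros y Hy. apply (Hpsi y (Hin y Hy)).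
    + lra.
Qed.

(* Closed under differentiation as soon as it contains the derivative of
   [psi]; this is how smoothness of functions built on a local inverse is
   obtained. *)
Inductive rational_in (d : R) (psi : R -> R) : (R -> R) -> Prop :=
| rat_gen : rational_in d psi psi
| rat_const c : rational_in d psi (fun _ => c)
| rat_opp f : rational_in d psi f -> rational_in d psi (fun x => - f x)
| rat_plus f g : rational_in d psi f -> rational_in d psi g ->
    rational_in d psi (fun x => f x + g x)
| rat_mult f g : rational_in d psi f -> rational_in d psi g ->
    rational_in d psi (fun x => f x * g x)
| rat_inv f : rational_in d psi f -> (forall x, Rabs x < d -> f x <> 0) ->
    rational_in d psi (fun x => / f x).

Lemma rat_pow (d : R) (psi f : R -> R) (n : nat) :
  rational_in d psi f -> rational_in d psi (fun x => f x ^ n).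
Proof.
  intros H. induction n as [|n IH]; simpl.
  - apply rat_const.
  - apply (rat_mult d psi f (fun x => f x ^ n) H IH).
Qed.

Lemma rational_derive (d : R) (psi dpsi f : R -> R) :
  (forall x, Rabs x < d -> is_derive psi x (dpsi x)) -> rational_in d psi dpsi ->
  rational_in d psi f ->
  exists g, rational_in d psi g /\ forall x, Rabs x < d -> is_derive f x (g x).
Proof.
  intros Hd Hr H. induction H as [|c|f Hf IHf|f g Hf IHf Hg IHg|f g Hf IHf Hg IHg
                                 |f Hf IHf Hnz].
  - exists dpsi. auto.
  - exists (fun _ => 0). split; [apply rat_const|].
    intros x _. apply (is_derive_const c x).
  - destruct IHf as (f' & Rf & Df). exists (fun x => - f' x).
    split; [apply rat_opp, Rf|]. intros x Hx.
    apply (is_derive_opp f x (f' x)), Df, Hx.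
  - destruct IHf as (f' & Rf & Df). destruct IHg as (g' & Rg & Dg).
    exists (fun x => f' x + g' x). split; [apply rat_plus; assumption|].
    intros x Hx. apply (is_derive_plus f g x (f' x) (g' x)); auto.
  - destruct IHf as (f' & Rf & Df). destruct IHg as (g' & Rg & Dg).
    exists (fun x => f' x * g x + f x * g' x).
    split; [apply rat_plus; apply rat_mult; assumption|].
    intros x Hx. apply (is_derive_mult f g x (f' x) (g' x));
      [auto | auto | intros; apply Rmult_comm].
  - destruct IHf as (f' & Rf & Df).
    exists (fun x => - f' x * / f x ^ 2). split.
    + apply rat_mult; [apply rat_opp, Rf|].
      apply (rat_inv d psi (fun x => f x ^ 2)).
      * apply rat_pow, Hf.
      * intros x Hx. apply pow_nonzero, Hnz, Hx.
    + intros x Hx. apply (is_derive_inv f x (f' x)); auto.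
Qed.

Lemma locally_0_abs (d : R) (P : R -> Prop) :
  0 < d -> (forall x, Rabs x < d -> P x) -> locally 0 P.
Proof.
  intros Hd H. exists (mkposreal d Hd). intros x Hx.
  change (Rabs (x - 0) < d) in Hx. rewrite Rminus_0_r in Hx. auto.
Qed.

Lemma locally_abs (d x : R) : Rabs x < d -> locally x (fun t => Rabs t < d).
Proof.
  intros Hx. assert (H0 : 0 < d - Rabs x) by lra.
  exists (mkposreal _ H0). intros y Hy. change (Rabs (y - x) < d - Rabs x) in Hy.
  replace y with (y - x + x) by ring.
  eapply Rle_lt_trans; [apply Rabs_triang|]. lra.
Qed.

Lemma rational_smooth (d : R) (psi dpsi : R -> R) :
  (forall x, Rabs x < d -> is_derive psi x (dpsi x)) -> rational_in d psi dpsi ->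
  forall n f g x y, rational_in d psi f -> rational_in d psi g -> Rabs x < d ->
  ex_diff_n (fun x y => y * f x + g x) n x y.
Proof.
  intros Hd Hr n. induction n as [|n IH]; intros f g x y Hf Hg Hx;
    destruct (rational_derive _ _ _ _ Hd Hr Hf) as (f' & Rf & Df);
    destruct (rational_derive _ _ _ _ Hd Hr Hg) as (g' & Rg & Dg);
    (assert (Hc : continuity_2d_pt (fun x y => y * f x + g x) x y);
     [ apply continuity_2d_pt_plus;
       [ apply continuity_2d_pt_mult; [apply continuity_2d_pt_id2|];
         apply (continuity_1d_2d_pt_comp f (fun x _ => x));
         [ apply ex_derive_continuity_pt; exists (f' x); auto
         | apply continuity_2d_pt_id1 ]
       | apply (continuity_1d_2d_pt_comp g (fun x _ => x));
         [ apply ex_derive_continuity_pt; exists (g' x); auto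
         | apply continuity_2d_pt_id1 ] ] |]).
  - split; [exact Hc | exact I].
  - assert (Dx : forall t z, Rabs t < d ->
      is_derive (fun t => z * f t + g t) t (z * f' t + g' t)).
    { intros t z Ht. apply (is_derive_plus (fun t => z * f t) g t).
      - apply is_derive_scal; auto.
      - auto. }
    assert (Dy : forall t z, is_derive (fun z => z * f t + g t) z (f t))
      by (intros; auto_derive; trivial; ring).
    simpl. split; [exact Hc|].
    split; [exists (y * f' x + g' x); apply Dx, Hx|].
    split; [exists (f x); apply Dy|].
    split.
    + apply (ex_diff_n_ext_loc (fun x y => y * f' x + g' x)); [|apply IH; auto].
      destruct (locally_abs d x Hx) as [e He]. exists e. intros t z Ht _.
      symmetry. apply is_derive_unique, Dx, He, Ht.
    + apply (ex_diff_n_ext_loc (fun x y => y * 0 + f x)).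
      * exists (mkposreal 1 Rlt_0_1). intros t z _ _.
        symmetry. rewrite Rmult_0_r, Rplus_0_l. apply is_derive_unique, Dy.
      * apply (IH (fun _ => 0) f); auto. apply rat_const.
Qed.

Lemma rational_smooth_near0 (d : R) (psi dpsi f g : R -> R) (F : R -> R -> R) :
  0 < d -> (forall x, Rabs x < d -> is_derive psi x (dpsi x)) ->
  rational_in d psi dpsi -> rational_in d psi f -> rational_in d psi g ->
  (forall x y, F x y = y * f x + g x) -> smooth_near0 F.
Proof.
  intros Hd0 Hd Hr Hf Hg E. exists (mkposreal d Hd0). intros n x y Hx _.
  apply (ex_diff_n_ext_loc (fun x y => y * f x + g x)).
  - exists (mkposreal 1 Rlt_0_1). intros; symmetry; apply E.
  - apply (rational_smooth d psi dpsi); assumption.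
Qed.

Lemma rational_jet (d : R) (psi dpsi f : R -> R) :
  0 < d -> (forall x, Rabs x < d -> is_derive psi x (dpsi x)) ->
  rational_in d psi dpsi -> rational_in d psi f ->
  exists c : R, is_derive f 0 c /\ jet (fun x _ => f x) (f 0) c 0.
Proof.
  intros Hd0 Hd Hr Hf.
  assert (Hz : Rabs 0 < d) by (rewrite Rabs_R0; exact Hd0).
  destruct (rational_derive _ _ _ _ Hd Hr Hf) as (f' & Rf & Df).
  destruct (rational_derive _ _ _ _ Hd Hr Rf) as (f2 & _ & Df2).
  exists (f' 0). split; [apply Df, Hz|].
  apply (jet_of_derive f f' (f2 0)); [|apply Df2, Hz].
  apply (locally_0_abs d); assumption.
Qed.

(** * The normal form of alpha *)

Lemma rigid_similarity (p q s t k c : R) :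
  0 < s -> 0 < t -> s^2 = p^2 + q^2 -> t^2 = 1 + k^2 ->
  similarity (fun x : R4 => vec4
    ((p * (co3 x - k^2) + q * (co4 x - c)) / s)
    ((co1 x + k * co2 x) / t)
    ((co2 x - k * co1 x) / t)
    ((- q * (co3 x - k^2) + p * (co4 x - c)) / s)).
Proof.
  intros Hs Ht Hs2 Ht2. exists 1. split; [lra|]. intros x y.
  rewrite Rmult_1_l. unfold enorm. f_equal.
  unfold dot. autorewrite with r4.
  generalize (co1 x) (co2 x) (co3 x) (co4 x) (co1 y) (co2 y) (co3 y) (co4 y).
  intros x1 x2 x3 x4 y1 y2 y3 y4.
  transitivity (((x1 - y1)^2 + (x2 - y2)^2) * ((1 + k^2) / t^2)
    + ((x3 - y3)^2 + (x4 - y4)^2) * ((p^2 + q^2) / s^2)); [field; lra|].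
  rewrite <- Hs2, <- Ht2. field; lra.
Qed.

(* The coordinate [x] of the graph runs along the [v]-direction of [alpha] and
   [y] along the [u]-direction; both are directions of axial lines, by the
   symmetry [u -> - u]. *)
Lemma alpha_normal_form (a eps v0 g sigma : R) :
  v0 <> 0 -> sigma^2 = 1 -> g = eps + a * v0^2 / 2 ->
  4 * v0^2 + g^2 = sigma * (1 + v0^2) * (g - a * v0^2) ->
  0 < 2 * (4 * v0^2 + g^2) + (4 + a * g) * (1 + v0^2) ->
  has_normal_form (alpha a eps) (0, v0)
    (8 - 4 * (2 * (sigma * a) * (1 + v0^2)^2 + 6 * (4 + a * g) * (1 + v0^2))
         / (2 * (4 * v0^2 + g^2) + (4 + a * g) * (1 + v0^2))) 0.
Proof.
  intros Hv0 Hsg Hg Hbr HDn.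
  set (W := 4 * v0^2 + g^2) in *. assert (HW : 0 < W) by (unfold W; nra).
  set (S := sqrt W). assert (HS : 0 < S) by (apply sqrt_lt_R0, HW).
  assert (HS2 : S^2 = W) by (apply pow2_sqrt; lra).
  set (w := 1 + v0^2) in *. assert (Hw : 0 < w) by (unfold w; nra).
  set (e := sqrt w). assert (He : 0 < e) by (apply sqrt_lt_R0, Hw).
  assert (He2 : e^2 = w) by (apply pow2_sqrt; lra).
  set (c := eps * v0 + a / 6 * v0^3).
  set (h := fun v => (2 * v0 * (v^2 - v0^2) + g * (eps * v + a / 6 * v^3 - c)) / S).
  set (h1 := fun v => (4 * v0 * v + g * (eps + a * v^2 / 2)) / S).
  set (h2 := fun v => (4 * v0 + g * a * v) / S).
  set (k := fun v => (- g * (v^2 - v0^2) + 2 * v0 * (eps * v + a / 6 * v^3 - c)) / S).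
  set (k1 := fun v => (- 2 * g * v + 2 * v0 * (eps + a * v^2 / 2)) / S).
  set (k2 := fun v => (- 2 * g + 2 * v0 * a * v) / S).
  set (k3 := 2 * v0 * a / S).
  assert (Dh : forall v, is_derive h v (h1 v))
    by (intros v; unfold h, h1; auto_derive; trivial; field; lra).
  assert (Dh1 : forall v, is_derive h1 v (h2 v))
    by (intros v; unfold h1, h2; auto_derive; trivial; field; lra).
  assert (Dk : forall v, is_derive k v (k1 v))
    by (intros v; unfold k, k1; auto_derive; trivial; field; lra).
  assert (Dk1 : forall v, is_derive k1 v (k2 v))
    by (intros v; unfold k1, k2; auto_derive; trivial; field; lra).
  assert (Dk2 : forall v, is_derive k2 v k3)
    by (intros v; unfold k2, k3; auto_derive; trivial; field; lra).
  assert (Hh0 : h v0 = 0) by (unfold h, c; field; lra).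
  assert (Hh1 : h1 v0 = S).
  { unfold h1. apply (Rmult_eq_reg_r S); [|lra].
    transitivity (S^2); [|ring]. rewrite HS2. unfold W.
    rewrite <- Hg. field; lra. }
  assert (Hh2 : h2 v0 = v0 * (4 + a * g) / S) by (unfold h2; field; lra).
  assert (Hk1 : k1 v0 = 0) by (unfold k1; rewrite <- Hg; field; lra).
  assert (Hk2 : k2 v0 = - 2 * sigma * S / w).
  { unfold k2. apply (Rmult_eq_reg_r (S * w)); [|nra].
    transitivity (- 2 * sigma * S^2); [|field; lra].
    rewrite HS2, Hbr.
    transitivity (- 2 * sigma^2 * (w * (g - a * v0^2))); [|ring].
    rewrite Hsg. field; lra. }
  assert (HU : locally v0 (fun v => 0 < 1 + v0 * v)).
  { assert (Hc : continuity_pt (fun v => 1 + v0 * v) v0) by reg.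
    apply continuity_pt_filterlim in Hc. apply Hc.
    assert (H1 : 0 < 1 + v0 * v0) by nra.
    exists (mkposreal _ H1). intros z Hz.
    change (Rabs (z - (1 + v0 * v0)) < 1 + v0 * v0) in Hz.
    apply Rabs_def2 in Hz. lra. }
  assert (Hc1 : continuity_pt h1 v0)
    by (apply ex_derive_continuity_pt; exists (h2 v0); apply Dh1).
  destruct (local_inverse h h1 v0 _ Dh Hc1 Hh0 ltac:(rewrite Hh1; exact HS) HU)
    as (d & psi & Hd & Hpsi0 & Hpsi).
  assert (Hz : Rabs 0 < d) by (rewrite Rabs_R0; exact Hd).
  assert (Dpsi : forall x, Rabs x < d -> is_derive psi x (/ h1 (psi x)))
    by (intros x Hx; apply (Hpsi x Hx)).
  assert (Hnz1 : forall x, Rabs x < d -> h1 (psi x) <> 0)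
    by (intros x Hx; destruct (Hpsi x Hx) as (_ & ? & _); lra).
  assert (HnzU : forall x, Rabs x < d -> 1 + v0 * psi x <> 0)
    by (intros x Hx; destruct (Hpsi x Hx) as (_ & _ & ? & _); lra).
  assert (Dcomp : forall (f : R -> R) (l x : R), Rabs x < d -> is_derive f (psi x) l ->
    is_derive (fun x => f (psi x)) x (l / h1 (psi x))).
  { intros f l x Hx Hf. replace (l / h1 (psi x)) with (/ h1 (psi x) * l)
      by (unfold Rdiv; ring).
    apply (is_derive_comp f psi x l (/ h1 (psi x)) Hf), Dpsi, Hx. }
  assert (Rh1 : rational_in d psi (fun x => h1 (psi x))).
  { unfold h1, Rdiv. repeat (apply rat_mult || apply rat_plus || apply rat_const
      || apply rat_gen || apply rat_pow). }
  assert (Rdpsi : rational_in d psi (fun x => / h1 (psi x)))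
    by (apply rat_inv; assumption).
  set (rho := fun v => (v - v0) / (1 + v0 * v)).
  set (rho1 := fun v => w / (1 + v0 * v)^2 / h1 v).
  set (rho2 := fun v =>
    - w * (2 * v0 / (1 + v0 * v)^3 / h1 v + h2 v / (1 + v0 * v)^2 / h1 v^2) / h1 v).
  set (s1 := fun v => k1 v / h1 v).
  set (s2 := fun v => (k2 v / h1 v - k1 v * h2 v / h1 v^2) / h1 v).
  assert (RU : rational_in d psi (fun x => / (1 + v0 * psi x)))
    by (apply (rat_inv d psi (fun x => 1 + v0 * psi x));
        [repeat constructor | exact HnzU]).
  assert (Rrho : rational_in d psi (fun x => rho (psi x))).
  { unfold rho, Rdiv, Rminus. apply rat_mult; [repeat constructor | exact RU]. }
  assert (Rrho1 : rational_in d psi (fun x => rho1 (psi x))).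
  { unfold rho1, Rdiv. apply rat_mult; [|exact Rdpsi].
    apply rat_mult; [apply rat_const|].
    apply (rat_inv d psi (fun x => (1 + v0 * psi x)^2)).
    - apply (rat_pow d psi (fun x => 1 + v0 * psi x)). repeat constructor.
    - intros x Hx. apply pow_nonzero, HnzU, Hx. }
  assert (Rrho2 : rational_in d psi (fun x => rho2 (psi x))).
  { assert (RUn : forall n, rational_in d psi (fun x => / (1 + v0 * psi x)^n)).
    { intros n. apply (rat_inv d psi (fun x => (1 + v0 * psi x)^n)).
      - apply (rat_pow d psi (fun x => 1 + v0 * psi x)). repeat constructor.
      - intros x Hx. apply pow_nonzero, HnzU, Hx. }
    assert (Rh2n : rational_in d psi (fun x => / h1 (psi x)^2)).
    { apply (rat_inv d psi (fun x => h1 (psi x)^2)).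
      - apply (rat_pow d psi (fun x => h1 (psi x))), Rh1.
      - intros x Hx. apply pow_nonzero, Hnz1, Hx. }
    unfold rho2, h2, Rdiv. clearbody h1.
    repeat first [ apply RUn | apply Rh2n | apply Rdpsi | apply rat_mult
      | apply rat_plus | apply rat_const | apply rat_gen ]. }
  assert (Rk : rational_in d psi (fun x => k (psi x))).
  { unfold k, Rdiv, Rminus. repeat first [ apply rat_mult | apply rat_plus
      | apply rat_const | apply rat_gen | apply rat_pow ]. }
  assert (Rk1 : rational_in d psi (fun x => k1 (psi x))).
  { unfold k1, Rdiv. repeat first [ apply rat_mult | apply rat_plus
      | apply rat_const | apply rat_gen | apply rat_pow ]. }
  assert (Rs1 : rational_in d psi (fun x => s1 (psi x)))
    by (apply rat_mult; assumption).
  assert (Rs2 : rational_in d psi (fun x => s2 (psi x))).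
  { assert (Rh2n : rational_in d psi (fun x => / h1 (psi x)^2)).
    { apply (rat_inv d psi (fun x => h1 (psi x)^2)).
      - apply (rat_pow d psi (fun x => h1 (psi x))), Rh1.
      - intros x Hx. apply pow_nonzero, Hnz1, Hx. }
    unfold s2, h2, k2, Rdiv, Rminus. clearbody h1 k1.
    repeat first [ apply Rh2n | apply Rdpsi | apply Rk1 | apply rat_mult
      | apply rat_plus | apply rat_opp | apply rat_const | apply rat_gen ]. }
  assert (Drho : forall v, 1 + v0 * v <> 0 ->
    is_derive rho v (w / (1 + v0 * v)^2)).
  { intros v Hv. unfold rho. auto_derive; [exact Hv|]. unfold w. field. exact Hv. }
  assert (Eh1 : forall v, Derive (fun x => h1 x) v = h2 v)
    by (intros; apply is_derive_unique, Dh1).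
  assert (Ek1 : forall v, Derive (fun x => k1 x) v = k2 v)
    by (intros; apply is_derive_unique, Dk1).
  assert (Eh2 : forall v, Derive (fun x => h2 x) v = g * a / S).
  { intros; apply is_derive_unique. unfold h2; auto_derive; trivial; field; lra. }
  assert (Ek2 : forall v, Derive (fun x => k2 x) v = k3)
    by (intros; apply is_derive_unique, Dk2).
  assert (Xh1 : forall v, ex_derive (fun x => h1 x) v)
    by (intros v; exists (h2 v); apply Dh1).
  assert (Xk1 : forall v, ex_derive (fun x => k1 x) v)
    by (intros v; exists (k2 v); apply Dk1).
  assert (Xk2 : forall v, ex_derive (fun x => k2 x) v)
    by (intros v; exists k3; apply Dk2).
  assert (Xh2 : forall v, ex_derive (fun x => h2 x) v)
    by (intros v; unfold h2; auto_derive; trivial).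
  clearbody h1 h2 k1 k2.
  assert (Drho1 : forall v, 1 + v0 * v <> 0 -> h1 v <> 0 ->
    is_derive rho1 v
      (- w * (2 * v0 / (1 + v0 * v)^3 / h1 v + h2 v / (1 + v0 * v)^2 / h1 v^2))).
  { intros v Hv Hv1. unfold rho1. auto_derive.
    - repeat split; auto.
    - rewrite Eh1. field. auto. }
  assert (Ds1 : forall v, h1 v <> 0 ->
    is_derive s1 v (k2 v / h1 v - k1 v * h2 v / h1 v^2)).
  { intros v Hv1. unfold s1. auto_derive; [auto|]. rewrite Eh1, Ek1. field. auto. }
  assert (Ds2 : is_derive s2 v0 (k3 / S^2 - 3 * k2 v0 * h2 v0 / S^3)).
  { unfold s2. auto_derive.
    - rewrite Hh1. repeat split; auto; nra.
    - rewrite Eh1, Ek1, Eh2, Ek2, Hk1, Hh1. field. lra. }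
  assert (Dr : forall x, Rabs x < d ->
    is_derive (fun x => rho (psi x)) x (rho1 (psi x)))
    by (intros x Hx; apply Dcomp; auto).
  assert (Dr1 : forall x, Rabs x < d ->
    is_derive (fun x => rho1 (psi x)) x (rho2 (psi x)))
    by (intros x Hx; apply Dcomp; auto).
  assert (Ds : forall x, Rabs x < d ->
    is_derive (fun x => k (psi x)) x (s1 (psi x)))
    by (intros x Hx; apply Dcomp; auto).
  assert (Dss : forall x, Rabs x < d ->
    is_derive (fun x => s1 (psi x)) x (s2 (psi x)))
    by (intros x Hx; apply Dcomp; auto).
  destruct (rational_jet d psi _ _ Hd Dpsi Rdpsi Rrho) as (r1 & E1 & J0).
  destruct (rational_jet d psi _ _ Hd Dpsi Rdpsi Rrho1) as (r2 & E2 & J1).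
  destruct (rational_jet d psi _ _ Hd Dpsi Rdpsi Rrho2) as (r3 & _ & J2).
  destruct (rational_jet d psi _ _ Hd Dpsi Rdpsi Rs1) as (q2 & F2 & K1).
  destruct (rational_jet d psi _ _ Hd Dpsi Rdpsi Rs2) as (q3 & F3 & K2).
  assert (Uniq : forall (f : R -> R) (x l l' : R), is_derive f x l -> is_derive f x l' -> l = l').
  { intros f x l l' H H'. rewrite <- (is_derive_unique _ _ _ H).
    apply is_derive_unique, H'. }
  pose proof (Uniq _ _ _ _ E1 (Dr 0 Hz)) as V1.
  pose proof (Uniq _ _ _ _ E2 (Dr1 0 Hz)) as V2.
  pose proof (Uniq _ _ _ _ F2 (Dss 0 Hz)) as V3.
  assert (V4 : q3 = (k3 / S^2 - 3 * k2 v0 * h2 v0 / S^3) / S).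
  { apply (Uniq _ _ _ _ F3). rewrite <- Hh1 at 3. rewrite <- Hpsi0 at 3.
    apply Dcomp; [exact Hz|]. rewrite Hpsi0. exact Ds2. }
  rewrite Hpsi0 in *.
  assert (Hww : 1 + v0 * v0 = w) by (unfold w; ring).
  assert (Z1 : r1 = / (w * S))
    by (rewrite V1; unfold rho1; rewrite Hh1, Hww; field; lra).
  assert (Z2 : r2 = - v0 / (w^2 * S^4) * (2 * W + (4 + a * g) * w))
    by (rewrite V2; unfold rho2; rewrite Hh1, Hh2, Hww, <- HS2; field; lra).
  assert (Z3 : q2 = - 2 * sigma / (w * S))
    by (rewrite V3; unfold s2; rewrite Hh1, Hk1, Hk2; field; lra).
  assert (Z4 : q3 = v0 / S^4 * (2 * a + 6 * sigma * (4 + a * g) / w))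
    by (rewrite V4, Hk2, Hh2; unfold k3; field; lra).
  assert (Y0 : rho v0 = 0)
    by (unfold rho; rewrite Hww; field; lra).
  assert (Y1 : s1 v0 = 0) by (unfold s1; rewrite Hk1; field; lra).
  rewrite Y0 in J0. rewrite Y1 in K1.
  rewrite <- V1 in J1. rewrite <- V2 in J2. rewrite <- V3 in K2.
  assert (Hr12 : r1 * r2 <> 0).
  { rewrite Z1, Z2. apply Rmult_integral_contrapositive_currified.
    - apply Rinv_neq_0_compat. nra.
    - apply Rmult_integral_contrapositive_currified; [|lra].
      apply Rmult_integral_contrapositive_currified; [lra|].
      apply Rinv_neq_0_compat, Rmult_integral_contrapositive_currified;
        apply pow_nonzero; lra. }
  exists (fun x y => y * rho (psi x)), (fun x _ => k (psi x)). split.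
  - split; [|split].
    + apply (rational_smooth_near0 d psi _ _ (fun _ => 0) _ Hd Dpsi Rdpsi Rrho);
        [apply rat_const | intros; ring].
    + apply (rational_smooth_near0 d psi _ (fun _ => 0) _ _ Hd Dpsi Rdpsi
        (rat_const _ _ 0) Rk). intros; ring.
    + eexists. exists (fun x y => y * (e * / (1 + v0 * psi x))), (fun x _ => psi x).
      split; [apply (rigid_similarity (2 * v0) g S e v0 c HS He)|].
      { rewrite HS2. unfold W. ring. }
      { exact He2. }
      split; [|split; [|split]].
      * apply (rational_smooth_near0 d psi _
          (fun x => e * / (1 + v0 * psi x)) (fun _ => 0) _ Hd Dpsi Rdpsi);
          [apply rat_mult; [apply rat_const | exact RU]
          | apply rat_const | intros; ring].
      * apply (rational_smooth_near0 d psi _ (fun _ => 0) _ _ Hd Dpsi Rdpsi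
          (rat_const _ _ 0) (rat_gen _ _)). intros; ring.
      * rewrite Hpsi0. f_equal. ring.
      * generalize (near_box d Hd). unfold near. apply filter_imp.
        intros [x y] [Hx _]. simpl fst in *. simpl snd in *.
        specialize (HnzU x Hx). destruct (Hpsi x Hx) as (Hhx & _).
        unfold alpha, graph. apply vec4_ext; autorewrite with r4.
        -- rewrite <- Hhx at 4. unfold h. field; lra.
        -- field; lra.
        -- unfold rho. field. lra.
        -- unfold k. field; lra.
  - replace (8 - _) with (8 - 2 * q2 * q3 / (r1 * r2)).
    + apply (graph_normal_form (fun x => rho (psi x)) (fun x => rho1 (psi x))
        (fun x => rho2 (psi x)) (fun x => k (psi x)) (fun x => s1 (psi x))
        (fun x => s2 (psi x)) r1 r2 r3 q2 q3);
        try (apply (locally_0_abs d); assumption); try assumption.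
      rewrite Z1, Z3.
      transitivity (4 * sigma^2 / (w * S)^2); [field; lra|].
      rewrite Hsg. field; lra.
    + rewrite Z1, Z2, Z3, Z4.
      replace (2 * (sigma * a) * w^2 + 6 * (4 + a * g) * w)
        with (2 * (sigma * a) * w^2 + 6 * sigma^2 * (4 + a * g) * w)
        by (rewrite Hsg; ring).
      field. repeat split; lra.
Qed.

(** * Types and count *)

Lemma Delta_mu0 (lam : R) :
  Defs.Delta lam 0 = (lam + 1)^3 * (lam^2 + 8 * lam + 32)^2 / 16.
Proof. unfold Defs.Delta, invI, invJ. field. Qed.

Lemma Delta_mu0_neg (lam : R) : lam < -1 -> Defs.Delta lam 0 < 0.
Proof.
  intros H. rewrite Delta_mu0.
  assert (0 < (lam^2 + 8 * lam + 32)^2) by (apply pow_lt; nra).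
  assert (0 < (- (lam + 1))^3) by (apply pow_lt; lra). nra.
Qed.

Lemma Delta_mu0_pos (lam : R) : -1 < lam -> Defs.Delta lam 0 > 0.
Proof.
  intros H. rewrite Delta_mu0.
  assert (0 < (lam^2 + 8 * lam + 32)^2) by (apply pow_lt; nra).
  assert (0 < (lam + 1)^3) by (apply pow_lt; lra). nra.
Qed.

Lemma jet_pos (f : R -> R -> R) (c0 c1 c2 : R) :
  jet f c0 c1 c2 -> 0 < c0 -> near (fun x y => 0 < f x y).
Proof.
  intros H Hc. generalize (jet_close _ _ _ _ _ H Hc). apply near_imp.
  intros x y K. apply Rabs_def2 in K. lra.
Qed.

Lemma near_implies (A : Prop) (P : R -> R -> Prop) :
  (A -> near P) -> near (fun x y => A -> P x y).
Proof.
  intros H. destruct (Classical_Prop.classic A) as [HA|HA].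
  - generalize (H HA). apply near_imp. auto.
  - apply near_forall. intros; contradiction.
Qed.

Lemma near_uniform (P : R -> R -> Prop) :
  near P -> exists d, 0 < d /\ forall x y, Rabs x < d -> Rabs y < d -> P x y.
Proof.
  intros [d Hd]. exists d. split; [apply cond_pos|]. intros x y Hx Hy.
  apply (Hd (x, y)). split; [change (Rabs (x - 0) < d) | change (Rabs (y - 0) < d)];
    rewrite Rminus_0_r; assumption.
Qed.

(* [lamN / lamD] is the quotient in [alpha_normal_form], with [w = v0^2] and
   [b = sigma a]. *)
Definition lamN (a b w g : R) : R := 2 * b * (1 + w)^2 + 6 * (4 + a * g) * (1 + w).
Definition lamD (a w g : R) : R := 2 * (4 * w + g^2) + (4 + a * g) * (1 + w).

Lemma lam_signs (a b : R) :
  near (fun w g => 0 < lamD a w g /\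
    (-15 / 2 < b -> 0 < 4 * lamN a b w g - 9 * lamD a w g) /\
    (b < -15 / 2 -> 0 < 9 * lamD a w g - 4 * lamN a b w g) /\
    (-8 < b -> 0 < lamN a b w g - 2 * lamD a w g) /\
    (b < -8 -> 0 < 2 * lamD a w g - lamN a b w g)).
Proof.
  unfold lamN, lamD.
  repeat apply near_and; try apply near_implies; try intros Hb;
    (eapply jet_pos; [jet_rules | lra]).
Qed.

Lemma alpha_types (a eps v g sigma : R) :
  v <> 0 -> sigma = 1 \/ sigma = -1 -> g = eps + a * v^2 / 2 ->
  axiumbilic (alpha a eps) (0, v) ->
  4 * v^2 + g^2 = sigma * (1 + v^2) * (g - a * v^2) ->
  0 < lamD a (v^2) g ->
  (0 < 4 * lamN a (sigma * a) (v^2) g - 9 * lamD a (v^2) g ->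
     type_E3 (alpha a eps) (0, v)) /\
  (0 < 9 * lamD a (v^2) g - 4 * lamN a (sigma * a) (v^2) g ->
   0 < lamN a (sigma * a) (v^2) g - 2 * lamD a (v^2) g ->
     type_E4 (alpha a eps) (0, v)) /\
  (0 < 2 * lamD a (v^2) g - lamN a (sigma * a) (v^2) g ->
     type_E5 (alpha a eps) (0, v)).
Proof.
  intros Hv Hs Hg Hax Hbr HD.
  assert (Hs2 : sigma^2 = 1) by (destruct Hs; subst; ring).
  pose proof (alpha_normal_form a eps v g sigma Hv Hs2 Hg Hbr HD) as Hnf.
  change (has_normal_form (alpha a eps) (0, v)
    (8 - 4 * lamN a (sigma * a) (v^2) g / lamD a (v^2) g) 0) in Hnf.
  set (N := lamN _ _ _ _) in *. set (D := lamD _ _ _) in *.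
  set (lam := 8 - 4 * N / D) in *.
  assert (Hlam : lam * D = 8 * D - 4 * N) by (unfold lam; field; lra).
  split; [|split]; intros H.
  - assert (lam < -1) by nra.
    split; [exact Hax|]. exists lam, 0. repeat split; [exact Hnf | lra |].
    apply Delta_mu0_neg; assumption.
  - intros H'. assert (-1 < lam) by nra. assert (lam < 0) by nra.
    split; [exact Hax|]. exists lam, 0.
    repeat split; [exact Hnf | lra | | lra | lra].
    apply Delta_mu0_pos; assumption.
  - assert (0 < lam) by nra.
    split; [exact Hax|]. exists lam, 0. repeat split; [exact Hnf | lra | | lra].
    apply Delta_mu0_pos; lra.
Qed.

Lemma branch_sign (a eps v sigma : R) :
  sigma = 1 \/ sigma = -1 ->
  branch (sigma * a) (sigma * eps) (v^2) <->
  4 * v^2 + (eps + a * v^2 / 2)^2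
  = sigma * (1 + v^2) * (eps + a * v^2 / 2 - a * v^2).
Proof. unfold branch. intros [-> | ->]; split; intros H; lra. Qed.

Lemma alpha_local_analysis (a : R) :
  exists d e0, 0 < d /\ 0 < e0 /\ forall eps, eps <> 0 -> Rabs eps < e0 ->
    (forall u v, Rabs v < d ->
       axiumbilic (alpha a eps) (u, v) <->
       (u = 0 /\ exists sigma, (sigma = 1 \/ sigma = -1) /\
          branch (sigma * a) (sigma * eps) (v^2))) /\
    (forall sigma, sigma = 1 \/ sigma = -1 ->
       ((-8 <= sigma * a /\ 0 < sigma * eps) \/
        (sigma * a < -8 /\ sigma * eps < 0) ->
        exists r, 0 < r /\ forall v,
          (Rabs v < d /\ branch (sigma * a) (sigma * eps) (v^2)) <->
          (v = r \/ v = - r)) /\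
       ((-8 <= sigma * a /\ sigma * eps < 0) \/
        (sigma * a < -8 /\ 0 < sigma * eps) ->
        forall v, Rabs v < d -> ~ branch (sigma * a) (sigma * eps) (v^2))) /\
    (forall sigma v, sigma = 1 \/ sigma = -1 -> Rabs v < d ->
       branch (sigma * a) (sigma * eps) (v^2) ->
       (-15 / 2 < sigma * a -> type_E3 (alpha a eps) (0, v)) /\
       (-8 < sigma * a < -15 / 2 -> type_E4 (alpha a eps) (0, v)) /\
       (sigma * a < -8 -> type_E5 (alpha a eps) (0, v))).
Proof.
  destruct (near_uniform _ (near_and _ _ (lam_signs a (1 * a)) (lam_signs a (-1 * a))))
    as (kap & Hkap & Hlam).
  destruct (branch_small_roots (1 * a)) as (h1 & Hh1 & B1).
  destruct (branch_small_roots (-1 * a)) as (h2 & Hh2 & B2).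
  pose proof (Rabs_pos a) as Ha.
  set (eta := Rmin (kap / (Rabs a + 1)) (Rmin h1 h2)).
  assert (Hk : 0 < kap / (Rabs a + 1)) by (apply Rdiv_lt_0_compat; lra).
  assert (Heta : 0 < eta) by (repeat apply Rmin_pos; assumption).
  assert (He1 : eta <= h1)
    by (eapply Rle_trans; [apply Rmin_r | apply Rmin_l]).
  assert (He2 : eta <= h2)
    by (eapply Rle_trans; [apply Rmin_r | apply Rmin_r]).
  assert (Hek : eta * (Rabs a + 1) <= kap).
  { assert (H : eta <= kap / (Rabs a + 1)) by apply Rmin_l.
    apply (Rmult_le_compat_r (Rabs a + 1)) in H; [|lra].
    replace (kap / (Rabs a + 1) * (Rabs a + 1)) with kap in H by (field; lra).
    exact H. }
  clearbody eta.
  destruct (B1 eta (conj Heta He1)) as (f1 & Hf1 & C1).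
  destruct (B2 eta (conj Heta He2)) as (f2 & Hf2 & C2).
  set (d := sqrt eta). assert (Hd : 0 < d) by (apply sqrt_lt_R0, Heta).
  assert (Hd2 : d^2 = eta) by (apply pow2_sqrt; lra).
  assert (Hvd : forall v, Rabs v < d <-> v^2 < eta).
  { intros v. rewrite <- (pow2_abs v), <- Hd2. pose proof (Rabs_pos v).
    split; intros; nra. }
  exists d, (Rmin (Rmin (1/2) (kap / 2)) (Rmin f1 f2)).
  split; [exact Hd|]. split; [repeat apply Rmin_pos; lra|].
  intros eps Heps Hsmall.
  assert (Hs1 : Rabs eps < Rmin (1/2) (kap / 2))
    by (eapply Rlt_le_trans; [exact Hsmall | apply Rmin_l]).
  assert (Hs2 : Rabs eps < Rmin f1 f2)
    by (eapply Rlt_le_trans; [exact Hsmall | apply Rmin_r]).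
  assert (E1 : Rabs eps < 1/2) by (eapply Rlt_le_trans; [exact Hs1 | apply Rmin_l]).
  assert (E2 : Rabs eps < kap / 2)
    by (eapply Rlt_le_trans; [exact Hs1 | apply Rmin_r]).
  assert (E3 : Rabs eps < f1) by (eapply Rlt_le_trans; [exact Hs2 | apply Rmin_l]).
  assert (E4 : Rabs eps < f2) by (eapply Rlt_le_trans; [exact Hs2 | apply Rmin_r]).
  assert (Hsig : forall sigma, sigma = 1 \/ sigma = -1 ->
    Rabs (sigma * eps) = Rabs eps /\ sigma * eps <> 0).
  { intros sigma [-> | ->].
    - rewrite Rmult_1_l. auto.
    - replace (-1 * eps) with (- eps) by ring. rewrite Rabs_Ropp. split; lra. }
  assert (Hsmallv : forall v, Rabs v < d ->
    Rabs (v^2) < kap /\ Rabs (eps + a * v^2 / 2) < kap).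
  { intros v Hv. apply Hvd in Hv. pose proof (pow2_ge_0 v) as Hv0.
    rewrite Rabs_pos_eq by exact Hv0. split; [nra|].
    eapply Rle_lt_trans; [apply Rabs_triang|].
    replace (a * v^2 / 2) with (a * (v^2 / 2)) by field.
    rewrite Rabs_mult, (Rabs_pos_eq (v^2 / 2)) by lra. nra. }
  assert (Hcrit : forall u v, Rabs v < d ->
       axiumbilic (alpha a eps) (u, v) <->
       (u = 0 /\ exists sigma, (sigma = 1 \/ sigma = -1) /\
          branch (sigma * a) (sigma * eps) (v^2))).
  { intros u v Hv. destruct (Hsmallv v Hv) as [L1 L2].
    destruct (Hlam _ _ L1 L2) as [[HD _] _].
    rewrite (alpha_axiumbilic_small a eps u v _ eq_refl Heps) by (trivial; lra).
    split; intros (-> & sigma & Hs & H); (split; [reflexivity|]); exists sigma;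
      (split; [exact Hs|]); apply (branch_sign a eps v sigma Hs); exact H. }
  split; [exact Hcrit|]. split.
  - intros sigma Hs. destruct (Hsig sigma Hs) as [Hse Hse0].
    assert (HC : ((-8 <= sigma * a /\ 0 < sigma * eps) \/
                  (sigma * a < -8 /\ sigma * eps < 0) ->
       exists w, 0 < w < eta /\ branch (sigma * a) (sigma * eps) w /\
         forall w', 0 <= w' < eta -> branch (sigma * a) (sigma * eps) w' -> w' = w) /\
      ((-8 <= sigma * a /\ sigma * eps < 0) \/
       (sigma * a < -8 /\ 0 < sigma * eps) ->
       forall w, 0 <= w < eta -> ~ branch (sigma * a) (sigma * eps) w)).
    { destruct Hs as [-> | ->]; [apply C1 | apply C2]; try exact Hse0;
        rewrite Hse; assumption. }
    destruct HC as [Hgood Hbad]. split.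
    + intros Hc. destruct (Hgood Hc) as (w & Hw & Hbw & Huniq).
      assert (Hr : 0 < sqrt w) by (apply sqrt_lt_R0; lra).
      assert (Hr2 : sqrt w ^ 2 = w) by (apply pow2_sqrt; lra).
      exists (sqrt w). split; [exact Hr|]. set (r := sqrt w) in *.
      intros v. rewrite Hvd. split.
      * intros [Hv Hbv].
        assert (Hvw : v^2 = w)
          by (apply Huniq; [pose proof (pow2_ge_0 v); lra | exact Hbv]).
        assert (Hz : (v - r) * (v + r) = 0) by lra.
        apply Rmult_integral in Hz. destruct Hz; [left | right]; lra.
      * intros [-> | ->].
        -- rewrite Hr2. split; [lra | exact Hbw].
        -- replace ((- r)^2) with (r^2) by ring. rewrite Hr2.
           split; [lra | exact Hbw].
    + intros Hc v Hv. apply Hvd in Hv. apply (Hbad Hc).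
      pose proof (pow2_ge_0 v); lra.
  - intros sigma v Hs Hv Hb.
    assert (Hv0 : v <> 0).
    { intros ->. unfold branch in Hb. destruct (Hsig sigma Hs) as [Hse Hse0].
      assert (Hz : sigma * eps * (1 - sigma * eps) = 0) by lra.
      rewrite <- Hse in E1. apply Rabs_def2 in E1.
      apply Rmult_integral in Hz. destruct Hz; lra. }
    destruct (Hsmallv v Hv) as [L1 L2].
    assert (HL : 0 < lamD a (v^2) (eps + a * v^2 / 2) /\
      (-15 / 2 < sigma * a -> 0 < 4 * lamN a (sigma * a) (v^2) (eps + a * v^2 / 2)
         - 9 * lamD a (v^2) (eps + a * v^2 / 2)) /\
      (sigma * a < -15 / 2 -> 0 < 9 * lamD a (v^2) (eps + a * v^2 / 2)
         - 4 * lamN a (sigma * a) (v^2) (eps + a * v^2 / 2)) /\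
      (-8 < sigma * a -> 0 < lamN a (sigma * a) (v^2) (eps + a * v^2 / 2)
         - 2 * lamD a (v^2) (eps + a * v^2 / 2)) /\
      (sigma * a < -8 -> 0 < 2 * lamD a (v^2) (eps + a * v^2 / 2)
         - lamN a (sigma * a) (v^2) (eps + a * v^2 / 2))).
    { destruct (Hlam _ _ L1 L2) as [HL1 HL2].
      destruct Hs as [-> | ->]; assumption. }
    destruct HL as (HD & H3 & H4 & H4' & H5).
    assert (Hax : axiumbilic (alpha a eps) (0, v))
      by (apply Hcrit; [exact Hv | split; [reflexivity | exists sigma; auto]]).
    apply (branch_sign a eps v sigma Hs) in Hb.
    destruct (alpha_types a eps v _ sigma Hv0 Hs eq_refl Hax Hb HD) as (T3 & T4 & T5).
    split; [|split].
    + intros H. apply T3, H3, H.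
    + intros [H H']. apply T4; [apply H4, H' | apply H4', H].
    + intros H. apply T5, H5, H.
Qed.

Lemma branch_signs_exclusive (a eps w : R) :
  0 < w -> branch (1 * a) (1 * eps) w -> branch (-1 * a) (-1 * eps) w -> False.
Proof. unfold branch. intros Hw H1 H2. nra. Qed.

(* The hypothesis a * eps < 0 in the last clause is not in the source: for
   15/2 < |a| < 8 and a * eps > 0 both points are of type E_3 (the normal form
   has mu = 0 and lam close to -(16 + 2|a|)), so the clause fails there. *)
Theorem proposition9 :
  forall a : R,
  exists (V : R * R -> Prop) (eps0 : R),
    locally (0, 0) V /\ 0 < eps0 /\
    forall eps : R, eps <> 0 -> Rabs eps < eps0 ->
      (Rabs a <= 8 -> has_exactly 2 (axiumbilic_in V (alpha a eps))) /\
      (8 < a ->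
         (0 < eps -> has_exactly 4 (axiumbilic_in V (alpha a eps))) /\
         (eps < 0 -> has_exactly 0 (axiumbilic_in V (alpha a eps)))) /\
      (a < -8 ->
         (eps < 0 -> has_exactly 4 (axiumbilic_in V (alpha a eps))) /\
         (0 < eps -> has_exactly 0 (axiumbilic_in V (alpha a eps)))) /\
      (8 < a -> 0 < eps ->
         exists p1 p2 p3 p4 : R * R,
           enumerates (p1 :: p2 :: p3 :: p4 :: nil)
                      (axiumbilic_in V (alpha a eps)) /\
           type_E3 (alpha a eps) p1 /\ type_E3 (alpha a eps) p2 /\
           type_E5 (alpha a eps) p3 /\ type_E5 (alpha a eps) p4) /\
      (a < -8 -> eps < 0 ->
         exists p1 p2 p3 p4 : R * R,
           enumerates (p1 :: p2 :: p3 :: p4 :: nil)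
                      (axiumbilic_in V (alpha a eps)) /\
           type_E3 (alpha a eps) p1 /\ type_E3 (alpha a eps) p2 /\
           type_E5 (alpha a eps) p3 /\ type_E5 (alpha a eps) p4) /\
      (Rabs a < 15 / 2 ->
         forall p : R * R, axiumbilic_in V (alpha a eps) p ->
           type_E3 (alpha a eps) p) /\
      (15 / 2 < Rabs a < 8 -> a * eps < 0 ->
         forall p : R * R, axiumbilic_in V (alpha a eps) p ->
           type_E4 (alpha a eps) p).
Proof.
  intros a. destruct (alpha_local_analysis a) as (d & e0 & Hd & He0 & Hloc).
  set (V := fun p : R * R => Rabs (fst p) < d /\ Rabs (snd p) < d).
  exists V, e0. split; [exact (near_box d Hd)|]. split; [exact He0|].
  intros eps Heps Hsmall. destruct (Hloc eps Heps Hsmall) as (Hcrit & Hroots & Htypes).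
  clear Hloc. set (P := axiumbilic_in V (alpha a eps)).
  assert (HP : forall p, P p <-> exists sigma v, (sigma = 1 \/ sigma = -1) /\
    p = (0, v) /\ Rabs v < d /\ branch (sigma * a) (sigma * eps) (v^2)).
  { intros [u v]. unfold P, axiumbilic_in, V; simpl fst; simpl snd. split.
    - intros [[_ Hv] H]. apply (Hcrit u v Hv) in H.
      destruct H as (-> & sigma & Hs & Hb). exists sigma, v. auto.
    - intros (sigma & v' & Hs & E & Hv & Hb). injection E as -> ->.
      rewrite Rabs_R0. split; [auto|].
      apply Hcrit; [exact Hv | split; [reflexivity | exists sigma; auto]]. }
  assert (Hneg : forall sigma, sigma = 1 \/ sigma = -1 -> - sigma = 1 \/ - sigma = -1)
    by (intros sigma [-> | ->]; [right | left]; ring).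
  assert (Heither : forall sigma tau, sigma = 1 \/ sigma = -1 ->
    tau = 1 \/ tau = -1 -> tau = sigma \/ tau = - sigma)
    by (intros sigma tau [-> | ->] [-> | ->]; lra).
  assert (Hnone : forall sigma, sigma = 1 \/ sigma = -1 ->
    sigma * a < -8 -> 0 < sigma * eps -> has_exactly 0 P).
  { intros sigma Hs Ha He. exists nil. split; [reflexivity|]. split; [constructor|].
    intros p. split; [intros []|]. intros Hp. apply HP in Hp.
    destruct Hp as (tau & v & Ht & _ & Hv & Hb).
    destruct (Heither sigma tau Hs Ht) as [-> | ->].
    - apply (proj2 (Hroots sigma Hs) ltac:(right; lra) v Hv Hb).
    - apply (proj2 (Hroots (- sigma) (Hneg _ Hs)) ltac:(left; lra) v Hv Hb). }
  assert (Htwo : forall sigma, sigma = 1 \/ sigma = -1 ->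
    -8 <= sigma * a <= 8 -> 0 < sigma * eps -> has_exactly 2 P).
  { intros sigma Hs Ha He.
    destruct (proj1 (Hroots sigma Hs) ltac:(left; lra)) as (r & Hr & Hr').
    exists ((0, r) :: (0, - r) :: nil). split; [reflexivity|]. split.
    - repeat constructor; simpl; intros H; decompose [or] H; try contradiction.
      injection H0; lra.
    - intros p. rewrite HP. simpl. split.
      + intros [<- | [<- | []]]; [exists sigma, r | exists sigma, (- r)];
          (split; [exact Hs|]); (split; [reflexivity|]); apply Hr'; auto.
      + intros (tau & v & Ht & -> & Hv & Hb).
        destruct (Heither sigma tau Hs Ht) as [-> | ->].
        * destruct (proj1 (Hr' v) (conj Hv Hb)) as [-> | ->]; auto.
        * exfalso.
          apply (proj2 (Hroots (- sigma) (Hneg _ Hs)) ltac:(left; lra) v Hv Hb). }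
  assert (Hfour : forall sigma, sigma = 1 \/ sigma = -1 ->
    8 < sigma * a -> 0 < sigma * eps ->
    exists p1 p2 p3 p4 : R * R,
      enumerates (p1 :: p2 :: p3 :: p4 :: nil) P /\
      type_E3 (alpha a eps) p1 /\ type_E3 (alpha a eps) p2 /\
      type_E5 (alpha a eps) p3 /\ type_E5 (alpha a eps) p4).
  { intros sigma Hs Ha He.
    destruct (proj1 (Hroots sigma Hs) ltac:(left; lra)) as (r & Hr & Hr').
    destruct (proj1 (Hroots (- sigma) (Hneg _ Hs)) ltac:(right; lra))
      as (t & Ht & Ht').
    assert (Hrt : r <> t).
    { intros <-. destruct (proj2 (Hr' r) (or_introl eq_refl)) as [_ B1].
      destruct (proj2 (Ht' r) (or_introl eq_refl)) as [_ B2].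
      assert (0 < r^2) by nra.
      destruct Hs as [-> | ->].
      - replace (- (1)) with (-1) in B2 by ring.
        apply (branch_signs_exclusive a eps (r^2)); assumption.
      - replace (- -1) with 1 in B2 by ring.
        apply (branch_signs_exclusive a eps (r^2)); assumption. }
    assert (T3 : forall v, v = r \/ v = - r -> type_E3 (alpha a eps) (0, v)).
    { intros v Hv. apply Hr' in Hv.
      apply (Htypes sigma v Hs (proj1 Hv) (proj2 Hv)). lra. }
    assert (T5 : forall v, v = t \/ v = - t -> type_E5 (alpha a eps) (0, v)).
    { intros v Hv. apply Ht' in Hv.
      apply (Htypes (- sigma) v (Hneg _ Hs) (proj1 Hv) (proj2 Hv)). lra. }
    exists (0, r), (0, - r), (0, t), (0, - t).
    split; [|split; [|split; [|split]]]; auto.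
    split.
    - repeat constructor; simpl; intros H; decompose [or] H; try contradiction;
        match goal with E : (0, _) = (0, _) |- _ => injection E; lra end.
    - intros p. rewrite HP. simpl. split.
      + intros [<- | [<- | [<- | [<- | []]]]];
          [exists sigma, r | exists sigma, (- r)
           | exists (- sigma), t | exists (- sigma), (- t)];
          (split; [auto|]); (split; [reflexivity|]);
          first [apply Hr'; solve [auto] | apply Ht'; solve [auto]].
      + intros (tau & v & Htau & -> & Hv & Hb).
        destruct (Heither sigma tau Hs Htau) as [-> | ->].
        * destruct (proj1 (Hr' v) (conj Hv Hb)) as [-> | ->]; auto.
        * destruct (proj1 (Ht' v) (conj Hv Hb)) as [-> | ->]; auto. }
  assert (Hfour_count : forall sigma, sigma = 1 \/ sigma = -1 ->
    8 < sigma * a -> 0 < sigma * eps -> has_exactly 4 P).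
  { intros sigma Hs Ha He.
    destruct (Hfour sigma Hs Ha He) as (p1 & p2 & p3 & p4 & H & _).
    exists (p1 :: p2 :: p3 :: p4 :: nil). split; [reflexivity | exact H]. }
  split; [|split; [|split; [|split; [|split; [|split]]]]].
  - intros Ha. apply Rabs_le_between in Ha.
    destruct (Rdichotomy _ _ Heps); [apply (Htwo (-1)) | apply (Htwo 1)];
      auto; lra.
  - intros Ha. split; intros He;
      [apply (Hfour_count 1) | apply (Hnone (-1))]; auto; lra.
  - intros Ha. split; intros He;
      [apply (Hfour_count (-1)) | apply (Hnone 1)]; auto; lra.
  - intros Ha He. apply (Hfour 1); auto; lra.
  - intros Ha He. apply (Hfour (-1)); auto; lra.
  - intros Ha p Hp. apply HP in Hp. destruct Hp as (sigma & v & Hs & -> & Hv & Hb).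
    apply Rabs_def2 in Ha. apply (Htypes sigma v Hs Hv Hb).
    destruct Hs as [-> | ->]; lra.
  - intros Ha Hae p Hp. apply HP in Hp.
    destruct Hp as (sigma & v & Hs & -> & Hv & Hb).
    assert (Ha8 : -8 < sigma * a).
    { destruct Ha as [_ Ha]. apply Rabs_def2 in Ha. destruct Hs as [-> | ->]; lra. }
    assert (Hse : 0 < sigma * eps).
    { destruct (Rtotal_order (sigma * eps) 0) as [Hn | [Hn | Hn]]; [| | exact Hn].
      - exfalso. apply (proj2 (Hroots sigma Hs) ltac:(left; lra) v Hv Hb).
      - destruct Hs as [-> | ->]; lra. }
    assert (Hsa : sigma * a < 0) by (destruct Hs as [-> | ->]; nra).
    apply (Htypes sigma v Hs Hv Hb). split; [exact Ha8|].
    destruct Ha as [Ha _]. unfold Rabs in Ha.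
    destruct (Rcase_abs a), Hs as [-> | ->]; lra.
Qed.
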